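(* Let $(M,J)$ be an almost complex manifold, $(\Sigma,j)$ a closed Riemann surface, $u:(\Sigma,j)\to(M,J)$ an embedded pseudoholomorphic curve and $L=u(\Sigma)$. Then the Gromov operator $\check D_u:C^\infty(N_LM)\to\Omega^{0,1}(N_LM)$ coincides with the Cauchy–Riemann operator $\bar\partial_{\check J}$ of the NB-II structure $\check J$ on $N_LM$.
   Context: $u$ is pseudoholomorphic if $du\circ j=J\circ du$. Let $\mathcal X$ be the space of smooth maps $\Sigma\to M$ in a fixed homology class, and $\mathcal E\to\mathcal X$ the bundle with fiber $\mathcal E_u=\Omega^{0,1}(u^*TM)$, the space of anti-linear maps $T\Sigma\to TM$ over $u$. Pseudoholomorphic curves are zeros of the section $\bar\partial_J(u)=\frac12(du+J\circ du\circ j)$. For a pseudoholomorphic $u$, $D_u=D\bar\partial_J:C^\infty(u^*TM)\to\Omega^{0,1}(u^*TM)$ is the linearization (vertical differential) of $\bar\partial_J$ at the zero $u$. It satisfies $D_u\circ du=du\circ\bar\partial$ on $C^\infty(T\Sigma)$, and so descends to an operator $\check D_u$ on the quotients $C^\infty(u^*TM)/C^\infty(T\Sigma)=C^\infty(N_LM)\to\Omega^{0,1}(u^*TM)/\Omega^{0,1}(T\Sigma)=\Omega^{0,1}(N_LM)$. The NB-II structure $\check J$ on $N_LM=TM|_L/TL$: fix a $J$-invariant subbundle $F\subset TM|_L$ with $TL\oplus F=TM|_L$, identify $F\simeq N_LM$, fix an almost complex connection ($\nabla J=0$) with torsion $\frac14N_J$ ($N_J(X,Y)=[JX,JY]-J[JX,Y]-J[X,JY]-[X,Y]$)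 for which $L$ is totally geodesic, and let $\varphi$ be its exponential map from a neighborhood of the zero section of $F$ to a neighborhood of $L$. With $R^t:v\mapsto tv$ the fiberwise dilatation, $\check J=\lim_{t\to0}R^{1/t}_*(\varphi_*^{-1}J\varphi_* )R^t_*$. This extends to an almost complex structure on $N_LM$ independent of choices, for which the projection and the zero section are pseudoholomorphic, and the fibers are complex vector spaces with the structure induced by $J$. For a section $v:L\to N_LM$, $\bar\partial_{\check J}v=\frac12(dv+\check J\circ dv\circ j)$, which takes values in vertical vectors and is thus regarded as an element of $\Omega^{0,1}(N_LM)$. *)

(* Defs.v *)
(* Manifolds are C^oo manifolds without boundary, modelled on 'rV[R]_n.       *)
From HB Require Import structures.
From mathcomp Require Import all_boot all_order all_algebra.
From mathcomp Require Import all_classical all_reals all_analysis.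

Set Implicit Arguments.
Unset Strict Implicit.
Unset Printing Implicit Defensive.

Import Order.TTheory GRing.Theory Num.Theory.
Import numFieldTopology.Exports numFieldNormedType.Exports.

Local Open Scope classical_set_scope.
Local Open Scope ring_scope.

(* C^r on an open set U.  Applied below only to finite-dimensional V, where   *)
(* continuity of all iterated directional derivatives is the usual notion.    *)
Fixpoint Cr_on {R : realType} {V W : normedModType R} (r : nat) (U : set V)
    (f : V -> W) : Prop :=
  match r with
  | 0 => forall x, U x -> {for x, continuous f}
  | r'.+1 => (forall x, U x -> differentiable f x) /\
             (forall v : V, Cr_on r' U (fun x => 'D_v f x))
  end.

Definition smooth_on {R : realType} {V W : normedModType R} (U : set V)
    (f : V -> W) : Prop := forall r, Cr_on r U f.

(* [at_ p] is a preferred chart around p (every manifold has such a choice).  *)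
(* T_pM is 'rV[R]_n, a tangent vector being identified with its coordinates   *)
(* in the chart [at_ p]; the functions [coord] and [vec] below translate to   *)
(* and from any other chart.                                                  *)
Record manifold (R : realType) (n : nat) := Manifold {
  points :> topologicalType;
  atlas_index : Type;
  dom : atlas_index -> set points;
  chart : atlas_index -> points -> 'rV[R]_n;
  chinv : atlas_index -> 'rV[R]_n -> points;
  at_ : points -> atlas_index;
  dom_at : forall p, dom (at_ p) p;
  dom_open : forall i, open (dom i);
  cod_open : forall i, open (chart i @` dom i);
  chart_continuous : forall i p, dom i p -> {for p, continuous (chart i)};
  chinv_continuous : forall i z, (chart i @` dom i) z ->
    {for z, continuous (chinv i)};
  chartK : forall i p, dom i p -> chinv i (chart i p) = p;
  transition_smooth : forall i j,
    smooth_on (chart i @` (dom i `&` dom j)) (chart j \o chinv i);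
  points_hausdorff : hausdorff_space points;
  points_second_countable : @second_countable points
}.
Arguments dom {R n} _ _ _.
Arguments chart {R n} _ _ _.
Arguments chinv {R n} _ _ _.
Arguments at_ {R n} _ _.

Section Calculus.
Context {R : realType}.

Definition coord n (M : manifold R n) (i : atlas_index M) (p : M)
    (v : 'rV[R]_n) : 'rV[R]_n :=
  'd (chart M i \o chinv M (at_ M p)) (chart M (at_ M p) p) v.

Definition vec n (M : manifold R n) (i : atlas_index M) (p : M)
    (w : 'rV[R]_n) : 'rV[R]_n :=
  'd (chart M (at_ M p) \o chinv M i) (chart M i p) w.

(* In the following four definitions A is meant to be open. *)
Definition smooth_into (V : normedModType R) n (M : manifold R n) (A : set V)
    (f : V -> M) : Prop :=
  (forall x, A x -> {for x, continuous f}) /\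
  forall a, smooth_on (A `&` f @^-1` dom M a) (chart M a \o f).

Definition smooth_map m n (X : manifold R m) (M : manifold R n) (A : set X)
    (f : X -> M) : Prop :=
  forall i, smooth_into (chart X i @` (dom X i `&` A)) (f \o chinv X i).

Definition smooth_fun m (X : manifold R m) (W : normedModType R) (A : set X)
    (f : X -> W) : Prop :=
  forall i, smooth_on (chart X i @` (dom X i `&` A)) (f \o chinv X i).

(* v is a smooth section of g^*TM over A. *)
Definition smooth_along m n (X : manifold R m) (M : manifold R n) (A : set X)
    (g : X -> M) (v : X -> 'rV[R]_n) : Prop :=
  forall i a, smooth_on (chart X i @` (dom X i `&` A `&` g @^-1` dom M a))
    (fun z => coord a (g (chinv X i z)) (v (chinv X i z))).

Definition tmap m n (X : manifold R m) (M : manifold R n) (f : X -> M) (x : X)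
    (v : 'rV[R]_m) : 'rV[R]_n :=
  'd (chart M (at_ M (f x)) \o f \o chinv X (at_ X x))
     (chart X (at_ X x) x) v.

Definition velocity n (M : manifold R n) (c : R -> M) (t : R) : 'rV[R]_n :=
  'D_1 (chart M (at_ M (c t)) \o c) t.

(* Smooth one-parameter family X -> M, with parameter in ]-e, e[. *)
Definition smooth_family m n (X : manifold R m) (M : manifold R n) (e : R)
    (U : R -> X -> M) : Prop :=
  forall i, @smooth_into (R * 'rV[R]_m)%type n M
    ([set t | - e < t < e] `*` (chart X i @` dom X i))
    (fun tz => U tz.1 (chinv X i tz.2)).

(* A homeomorphism onto its image which is an immersion. *)
Definition embedding m n (X : manifold R m) (M : manifold R n) (u : X -> M) :
    Prop :=
  [/\ smooth_map setT u, injective u, forall x, injective (tmap u x) &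
      forall A : set X, open A -> exists2 B : set M, open B & A = u @^-1` B].

Definition bracket n (M : manifold R n) (X Y : M -> 'rV[R]_n) (p : M) :
    'rV[R]_n :=
  let a := at_ M p in
  let loc (Z : M -> 'rV[R]_n) z := coord a (chinv M a z) (Z (chinv M a z)) in
  'd (loc Y) (chart M a p) (X p) - 'd (loc X) (chart M a p) (Y p).

End Calculus.

Record almost_complex (R : realType) (n : nat) (M : manifold R n) :=
  AlmostComplex {
  acs :> M -> 'rV[R]_n -> 'rV[R]_n;
  acs_linear : forall p, linear (acs p);
  acs_sqr : forall p v, acs p (acs p v) = - v;
  acs_smooth : forall a w, smooth_fun (dom M a)
    (fun p => coord a p (acs p (vec a p w)))
}.

(* [nabla Y p v] is the covariant derivative of Y at p in the direction v.    *)
(* Only its values on fields smooth near p matter ([nabla_local]).            *)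
Record connection (R : realType) (n : nat) (M : manifold R n) := Connection {
  nabla :> (M -> 'rV[R]_n) -> M -> 'rV[R]_n -> 'rV[R]_n;
  nabla_local : forall (A : set M) Y Z p v, open A -> A p ->
    smooth_along A id Y -> (forall q, A q -> Y q = Z q) ->
    nabla Y p v = nabla Z p v;
  nabla_linear : forall (A : set M) Y p, open A -> A p ->
    smooth_along A id Y -> linear (nabla Y p);
  nabla_add : forall (A : set M) Y Z p v, open A -> A p ->
    smooth_along A id Y -> smooth_along A id Z ->
    nabla (fun q => Y q + Z q) p v = nabla Y p v + nabla Z p v;
  nabla_leibniz : forall (A : set M) (f : M -> R) Y p v, open A -> A p ->
    smooth_fun A f -> smooth_along A id Y ->
    nabla (fun q => f q *: Y q) p v =
      f p *: nabla Y p v +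
      'd (f \o chinv M (at_ M p)) (chart M (at_ M p) p) v *: Y p;
  nabla_smooth : forall (A : set M) X Y, open A ->
    smooth_along A id X -> smooth_along A id Y ->
    smooth_along A id (fun p => nabla Y p (X p))
}.

Section Connections.
Context {R : realType} {n : nat} (M : manifold R n).

Definition nijenhuis (J : almost_complex M) (X Y : M -> 'rV[R]_n) (p : M) :
    'rV[R]_n :=
  let JX q := J q (X q) in
  let JY q := J q (Y q) in
  bracket JX JY p - J p (bracket JX Y p) - J p (bracket X JY p)
    - bracket X Y p.

Definition almost_complex_connection (J : almost_complex M)
    (D : connection M) : Prop :=
  forall (A : set M) Y p v, open A -> A p -> smooth_along A id Y ->
    D (fun q => J q (Y q)) p v = J p (D Y p v).

Definition minimal_torsion (J : almost_complex M) (D : connection M) : Prop :=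
  forall (A : set M) X Y p, open A -> A p ->
    smooth_along A id X -> smooth_along A id Y ->
    D Y p (X p) - D X p (Y p) - bracket X Y p = 4^-1 *: nijenhuis J X Y p.

(* With g the expression of c in the chart a = at_ (c t), the covariant       *)
(* acceleration at t is g''(t) + nabla_{g'(t)} E, where E is the field with   *)
(* constant coordinates g'(t) in a, i.e. g'' + Gamma(g', g').                 *)
Definition geodesic (D : connection M) (l r : R) (c : R -> M) : Prop :=
  smooth_into [set t : R | l < t < r] c /\
  forall t, l < t < r ->
    let a := at_ M (c t) in
    let g := chart M a \o c in
    'D_1 (fun s => 'D_1 g s) t + D (fun q => vec a q ('D_1 g t)) (c t) ('D_1 g t)
      = 0.

(* q = exp_p(v): the value at time 1 of the geodesic with initial velocity v. *)
Definition is_exp (D : connection M) (p : M) (v : 'rV[R]_n) (q : M) : Prop :=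
  let init l r c := [/\ l < 0, 1 < r, geodesic D l r c, c 0 = p &
                        velocity c 0 = v] in
  (exists l r c, init l r c) /\ (forall l r c, init l r c -> c 1 = q).

Definition totally_geodesic m (S : manifold R m) (u : S -> M)
    (D : connection M) : Prop :=
  forall (e : R) (c : R -> M) x xi, 0 < e -> geodesic D (- e) e c ->
    c 0 = u x -> velocity c 0 = tmap u x xi ->
    \forall t \near (0 : R), range u (c t).

End Connections.

(* Fiberwise operations are meaningful only within one fiber.                 *)
(* A local trivialization over V is e |-> (proj e, h e), with inverse g.      *)
Record vbundle (R : realType) (m : nat) (B : manifold R m) (k : nat) :=
  VBundle {
  total_space :> manifold R (m + k);
  proj : total_space -> B;
  fzero : B -> total_space;
  fadd : total_space -> total_space -> total_space;
  fscal : R -> total_space -> total_space;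
  proj_smooth : smooth_map setT proj;
  local_trivial : forall x0 : B, exists (V : set B) (h : total_space -> 'rV[R]_k)
      (g : B -> 'rV[R]_k -> total_space),
    [/\ open V /\ V x0,
        forall x w, V x -> proj (g x w) = x /\ h (g x w) = w,
        forall e, V (proj e) -> g (proj e) (h e) = e,
        smooth_fun (proj @^-1` V) h /\
        (forall i, @smooth_into R ('rV[R]_m * 'rV[R]_k)%type _ total_space
          ((chart B i @` (dom B i `&` V)) `*` setT)
          (fun zw => g (chinv B i zw.1) zw.2)) &
        forall x, V x ->
          [/\ fzero x = g x 0,
              forall w w', fadd (g x w) (g x w') = g x (w + w') &
              forall c w, fscal c (g x w) = g x (c *: w)]]
}.
Arguments proj {R m B k} _ _.
Arguments fzero {R m B k} _ _.
Arguments fadd {R m B k} _ _ _.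
Arguments fscal {R m B k} _ _ _.

Definition smooth_section (R : realType) m (B : manifold R m) k
    (E : vbundle B k) (nu : B -> E) : Prop :=
  smooth_map setT nu /\ forall x, proj E (nu x) = x.

(* The canonical identification of E_x (x = proj e) with the vertical         *)
(* subspace of T_eE.                                                          *)
Definition vlift (R : realType) m (B : manifold R m) k (E : vbundle B k)
    (e w : E) : 'rV[R]_(m + k) :=
  velocity (fun t : R => fadd E e (fscal E t w)) 0.

Definition pseudoholomorphic (R : realType) m n (S : manifold R m)
    (M : manifold R n) (j : almost_complex S) (J : almost_complex M)
    (u : S -> M) : Prop :=
  forall x xi, tmap u x (j x xi) = J (u x) (tmap u x xi).

Definition dbar (R : realType) m n (S : manifold R m) (M : manifold R n)
    (j : almost_complex S) (J : almost_complex M) (f : S -> M) (x : S)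
    (xi : 'rV[R]_m) : 'rV[R]_n :=
  2^-1 *: (tmap f x xi + J (f x) (tmap f x (j x xi))).

(* L = u(S) is identified with S through the embedding u.  The quotient       *)
(* bundle u^*TM / du(TS) is given as a vector bundle N together with the      *)
(* projection pi_x : T_{u x}M -> N_x, smooth, onto and with kernel du(T_xS).  *)
Definition normal_bundle (R : realType) m n k (S : manifold R m)
    (M : manifold R n) (u : S -> M) (N : vbundle S k)
    (pi : S -> 'rV[R]_n -> N) : Prop :=
  [/\ forall x v, proj N (pi x v) = x,
      (forall x v w, pi x (v + w) = fadd N (pi x v) (pi x w)) /\
      (forall x c v, pi x (c *: v) = fscal N c (pi x v)),
      forall e : N, exists v, pi (proj N e) v = e,
      forall x v, pi x v = fzero N x <-> exists xi, v = tmap u x xi &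
      forall a w, smooth_map (u @^-1` dom M a)
        (fun x => pi x (vec a (u x) w))].

(* A J-invariant complement F of du(TS) in u^*TM amounts to a smooth          *)
(* fiberwise linear right inverse s of pi, with F_x = s(N_x): s is the        *)
(* identification of N with F.                                                *)
Definition invariant_complement (R : realType) m n k (S : manifold R m)
    (M : manifold R n) (J : almost_complex M) (u : S -> M) (N : vbundle S k)
    (pi : S -> 'rV[R]_n -> N) (s : N -> 'rV[R]_n) : Prop :=
  [/\ forall e, pi (proj N e) (s e) = e,
      forall e e', proj N e = proj N e' -> s (fadd N e e') = s e + s e',
      forall c e, s (fscal N c e) = c *: s e,
      smooth_along setT (u \o proj N) s &
      forall e, exists2 e', proj N e' = proj N e &
        J (u (proj N e)) (s e) = s e'].

(* phi is the exponential map along F = s(N), a diffeomorphism (with inverse  *)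
(* psi) from the neighborhood W of the zero section onto a neighborhood of L. *)
Definition exponential_map (R : realType) m n k (S : manifold R m)
    (M : manifold R n) (u : S -> M) (N : vbundle S k) (s : N -> 'rV[R]_n)
    (D : connection M) (W : set N) (phi : N -> M) : Prop :=
  [/\ open W /\ (forall x, W (fzero N x)),
      forall e, W e -> is_exp D (u (proj N e)) (s e) (phi e),
      smooth_map W phi,
      open (phi @` W) /\ range u `<=` phi @` W &
      exists2 psi : M -> N, smooth_map (phi @` W) psi &
        forall e, W e -> psi (phi e) = e].

Definition pullback_acs (R : realType) m n (X : manifold R m)
    (M : manifold R n) (J : almost_complex M) (phi : X -> M) (e : X)
    (v : 'rV[R]_m) : 'rV[R]_m :=
  get [set w | tmap phi e w = J (phi e) (tmap phi e v)].

(* Since fscal t^-1 (fscal t e) = e for t != 0, all the vectors under the     *)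
(* limit lie in T_eN.                                                         *)
Definition dilatation_limit (R : realType) m n k (S : manifold R m)
    (M : manifold R n) (J : almost_complex M) (N : vbundle S k) (phi : N -> M)
    (Jc : almost_complex N) : Prop :=
  forall (e : N) (v : 'rV[R]_(m + k)),
    (fun t : R => tmap (fscal N t^-1) (fscal N t e)
       (pullback_acs J phi (fscal N t e) (tmap (fscal N t) e v)))
      @ (0 : R)^' --> Jc e v.

Definition NBII_structure (R : realType) n k (S : manifold R 2)
    (M : manifold R n) (J : almost_complex M) (u : S -> M) (N : vbundle S k)
    (pi : S -> 'rV[R]_n -> N) (Jc : almost_complex N) : Prop :=
  exists (s : N -> 'rV[R]_n) (D : connection M) (W : set N) (phi : N -> M),
    [/\ invariant_complement J u pi s,
        [/\ almost_complex_connection J D, minimal_torsion J D &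
            totally_geodesic u D],
        exponential_map u s D W phi &
        dilatation_limit J phi Jc].

(* D is the linearization of dbar_J at its zero u.  For a smooth curve        *)
(* t |-> U t of maps with U 0 = u and derivative v at t = 0,                  *)
(* dbar_J (U t) (x) (xi) is a curve in TM through the zero vector of          *)
(* T_{u x}M; the vertical part of its derivative is obtained by               *)
(* differentiating its components in any chart around u x.                    *)
Definition linearization (R : realType) n (S : manifold R 2)
    (M : manifold R n) (j : almost_complex S) (J : almost_complex M)
    (u : S -> M) (D : (S -> 'rV[R]_n) -> S -> 'rV[R]_2 -> 'rV[R]_n) : Prop :=
  forall (v : S -> 'rV[R]_n) (e : R) (U : R -> S -> M),
    0 < e -> smooth_family e U -> (forall x, U 0 x = u x) ->
    (forall x, velocity (fun t => U t x) 0 = v x) ->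
    forall x xi, D v x xi =
      'D_1 (fun t : R => coord (at_ M (u x)) (U t x) (dbar j J (U t) x xi)) 0.

(* Dc is induced by D on the quotients by sections of TS and Omega^{0,1}(TS). *)
Definition induced_operator (R : realType) n k (S : manifold R 2)
    (M : manifold R n) (u : S -> M) (N : vbundle S k)
    (pi : S -> 'rV[R]_n -> N)
    (D : (S -> 'rV[R]_n) -> S -> 'rV[R]_2 -> 'rV[R]_n)
    (Dc : (S -> N) -> S -> 'rV[R]_2 -> N) : Prop :=
  forall v : S -> 'rV[R]_n, smooth_along setT u v ->
    forall x xi, Dc (fun y => pi y (v y)) x xi = pi x (D v x xi).

(* Main.v *)
(** Let [m_t] be the fiberwise dilatation by [t] and [e = nu x].  The operator
    [D_u] is computed along the family [u_t = phi o m_t o nu], whose velocity at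
    [t = 0] lifts [nu].  For [t != 0],
      [dbar_J u_t = d(phi o m_t)_e (eta_t)],
    where [eta_t] is the Cauchy-Riemann operator applied to [nu] for the rescaled
    structure [R^(1/t)_* (phi^* J) R^t_*]; hence [eta_t] tends to
    [eta_0 = dbar_Jc nu].  In a trivialization [(z, w)] of [N],
      [d(phi o m_t) (zeta, omega) = d_z phi (zeta) + t d_w phi (omega)].
    At [t = 0] the left-hand side vanishes while [d_z phi = du] is injective, so
    the limit [eta_0] is vertical.  Dividing by [t] and projecting to the normal
    bundle, which kills the image of [d_z phi] at [t = 0], gives in the limit
    that the class of [D_u v] is the vertical component of [eta_0]. *)
From HB Require Import structures.
From mathcomp Require Import all_boot all_order all_algebra.
From mathcomp Require Import all_classical all_reals all_analysis.
(* Required last: [coord] must denote [Defs.coord], not [vector.coord]. *)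
Require Import Defs.

Set Implicit Arguments.
Unset Strict Implicit.
Unset Printing Implicit Defensive.

Import Order.TTheory GRing.Theory Num.Theory.
Import numFieldTopology.Exports numFieldNormedType.Exports.

Local Open Scope classical_set_scope.
Local Open Scope ring_scope.

(** * Smooth maps between normed spaces *)

(** The obstacle is that the dilatation limit is only known pointwise: [eta_t] converges as [t]
    tends to 0, but neither a rate nor differentiability at 0 is available, so the formula for
    [dbar_J u_t] cannot be differentiated term by term. Division by [t] works nevertheless: after
    projection the coefficient d_z phi is a differentiable function of [t] that vanishes at 0 and so
    absorbs the factor 1/t, while its multiplier, the base component of [eta_t], tends to 0. This is
    why verticality of [eta_0] is settled before dividing. What survives is d_w phi on the zero
    section. It equals the inclusion [s] of the normal bundle as [F], because fiber rays go to
    geodesics with initial velocity [s e]; as [pi] inverts [s], the projection gives back the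
    vertical component itself. The linearization is specified through families of maps, so [u_t] has
    to be smooth on one parameter interval common to all points of the curve. This is where
    compactness enters. *)

Lemma open_preimage (T T' : topologicalType) (A : set T) (B : set T')
    (f : T -> T') : open A -> open B ->
  (forall x, A x -> {for x, continuous f}) -> open (A `&` f @^-1` B).
Proof.
move=> oA oB fA; rewrite openE => x [Ax Bfx]; apply: filterI.
  exact: open_nbhs_nbhs.
by apply: (fA x Ax); exact: open_nbhs_nbhs.
Qed.

Lemma open_setX (T T' : topologicalType) (A : set T) (B : set T') :
  open A -> open B -> open (A `*` B).
Proof.
move=> oA oB; rewrite openE => -[x y] [/= Ax By].
by exists (A, B) => //=; split; exact: open_nbhs_nbhs.
Qed.

Section SmoothCalculus.
Context {R : realType}.
Implicit Types V W X : normedModType R.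

Lemma differentiable_near V W (f g : V -> W) (x : V) :
  (\forall y \near x, f y = g y) -> differentiable f x -> differentiable g x.
Proof.
move=> fg df.
(* A first-order expansion determines the differential, so it is enough that [g] inherits the
   expansion of [f]. *)
suff E : g \o shift x = cst (g x) + 'd f x +o_ 0 id.
  have dfc : continuous ('d f x) by exact: diff_continuous.
  by apply/diff_locallyP; rewrite (diff_unique dfc E).
have /diff_locallyP[_ /eqaddoP E] := df.
apply/eqaddoP => _/posnumP[e]; have := E e%:num [gt0 of e%:num].
rewrite !near_simpl; apply: filter_app.
have : \forall h \near (0 : V), f (h + x) = g (h + x).
  by move: fg; rewrite (near_shift 0 x)/= subr0.
apply: filterS => h fgh; rewrite /= /cst.
by rewrite !fctE /= fgh -(nbhs_singleton fg).
Qed.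

Lemma diff_near V W (f g : V -> W) (x : V) v :
  (\forall y \near x, f y = g y) -> differentiable f x -> 'd f x v = 'd g x v.
Proof.
move=> fg df; have dg := differentiable_near fg df.
by rewrite -!deriveE//; exact: near_eq_derive.
Qed.

Lemma differentiable_id V (x : V) : differentiable (fun y : V => y) x.
Proof. by have [] := is_diff_id x. Qed.

Lemma diff_comp_eq V W X (f : V -> W) (g : W -> X) x v :
  differentiable f x -> differentiable g (f x) ->
  'd (g \o f) x v = 'd g (f x) ('d f x v).
Proof. by move=> df dg; rewrite diff_comp. Qed.

Lemma derive_comp V W X (f : V -> W) (g : W -> X) x v :
  differentiable f x -> differentiable g (f x) ->
  'D_v (fun y => g (f y)) x = 'd g (f x) ('D_v f x).
Proof.
move=> df dg; rewrite -[fun y => g (f y)]/(g \o f) !deriveE//.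
  exact: diff_comp_eq.
exact: differentiable_comp.
Qed.

Lemma near_open V (U : set V) x (P : V -> Prop) : open U -> U x ->
  (forall y, U y -> P y) -> \forall y \near x, P y.
Proof. by move=> oU Ux UP; apply: filterS UP _; exact: open_nbhs_nbhs. Qed.

(** Scalar multiplication is registered as a bilinear map so that the product rule for a scalar
    function times a vector-valued one follows from the differential of a continuous bilinear
    map. *)
Lemma scale_is_bilinear W :
  bilinear_for (GRing.Scale.Law.clone _ _ *:%R _) (GRing.Scale.Law.clone _ _ *:%R _)
    (@GRing.scale R W : R -> W -> W).
Proof.
split=> [u'|u] a x y /=.
- by rewrite scalerDl scalerA.
- by rewrite scalerDr !scalerA mulrC.
Qed.

HB.instance Definition _ W := bilinear_isBilinear.Build R R W W _ _
  (@GRing.scale R W : R -> W -> W) (scale_is_bilinear W).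

Lemma differentiable_scale V W (a : V -> R) (f : V -> W) x :
  differentiable a x -> differentiable f x ->
  differentiable (fun y => a y *: f y) x.
Proof.
move=> da df.
have -> : (fun y => a y *: f y) =
    (fun p : R * W => (@GRing.scale R W : R -> W -> W) p.1 p.2)
      \o (fun y => (a y, f y)) by [].
apply: differentiable_comp; first exact: differentiable_pair.
by apply: (@differentiable_bilin _ R W W) => p; exact: scale_continuous.
Qed.

Lemma derive_scale V W (a : V -> R) (f : V -> W) x v :
  differentiable a x -> differentiable f x ->
  'D_v (fun y => a y *: f y) x = a x *: 'D_v f x + 'D_v a x *: f x.
Proof.
move=> da df; rewrite !deriveE//; last exact: differentiable_scale.
have -> : (fun y => a y *: f y) =
    (fun p : R * W => (@GRing.scale R W : R -> W -> W) p.1 p.2)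
      \o (fun y => (a y, f y)) by [].
have sc : continuous (fun p : R * W => (@GRing.scale R W : R -> W -> W) p.1 p.2).
  by move=> p; exact: scale_continuous.
rewrite diff_comp//; last first.
- exact: (@differentiable_bilin _ R W W).
- exact: differentiable_pair.
by rewrite (@diff_bilin _ R W W _ _ sc)/= diff_pair.
Qed.

Lemma Cr_onS V W r (A B : set V) (f : V -> W) :
  A `<=` B -> Cr_on r B f -> Cr_on r A f.
Proof.
elim: r f => [|r IH] f AB /=; first by move=> fB x /AB; exact: fB.
move=> [fB DfB]; split=> [x /AB|v]; first exact: fB.
by apply: IH => //; exact: DfB.
Qed.

(** Every condition in [Cr_on] concerns a single point of the set, with differentiability and
    continuity taken in the whole space. Hence any set [U] through [x] serves as a witness. *)
Lemma Cr_on_local V W r (A : set V) (f : V -> W) :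
  (forall x, A x -> exists2 U : set V, U x & Cr_on r U f) -> Cr_on r A f.
Proof.
elim: r f => [|r IH] f Af /=; first by move=> x /Af[U Ux fU]; exact: fU.
split=> [x /Af[U Ux [fU _]]|v]; first exact: fU.
by apply: IH => x /Af[U Ux [_ Uf]]; exists U => //; exact: Uf.
Qed.

Lemma Cr_on_eq V W r (A : set V) (f g : V -> W) : open A ->
  (forall x, A x -> f x = g x) -> Cr_on r A f -> Cr_on r A g.
Proof.
move=> oA; elim: r f g => [|r IH] f g fg /=.
  move=> fA x Ax; have fgx : \forall y \near x, f y = g y by exact: near_open fg.
  rewrite /prop_for /continuous_at -fg//; apply: cvg_trans (fA x Ax).
  exact: near_eq_cvg.
move=> [fA DfA]; split=> [x Ax|v].
  apply: differentiable_near (fA x Ax); exact: near_open fg.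
apply: (IH (fun x => 'D_v f x)) => // x Ax.
by apply: near_eq_derive; exact: near_open fg.
Qed.

Lemma Cr_on_S V W r (A : set V) (f : V -> W) : Cr_on r.+1 A f -> Cr_on r A f.
Proof.
elim: r f => [|r IH] f.
  by move=> [fA _] x /fA; exact: differentiable_continuous.
by move=> [fA DfA]; split=> // v; apply: IH; exact: DfA.
Qed.

Lemma Cr_on_cst V W r (A : set V) (w : W) : Cr_on r A (fun _ : V => w).
Proof.
elim: r w => [|r IH] w /=; first by move=> x _; exact: cst_continuous.
split=> [x _|v]; first exact: differentiable_cst.
have -> : 'D_v (fun _ : V => w) = fun _ => 0 by apply/funext => x; exact: derive_cst.
exact: IH.
Qed.

Lemma Cr_on_add V W r (A : set V) (f g : V -> W) : open A ->
  Cr_on r A f -> Cr_on r A g -> Cr_on r A (fun x => f x + g x).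
Proof.
move=> oA; elim: r f g => [|r IH] f g /=.
  by move=> fA gA x Ax; apply: continuousD; [exact: fA|exact: gA].
move=> [fA DfA] [gA DgA]; split=> [x Ax|v].
  by apply: differentiableD; [exact: fA|exact: gA].
apply: (@Cr_on_eq _ _ _ _ (fun x => 'D_v f x + 'D_v g x)) => //; last exact: IH.
move=> x Ax; rewrite -deriveD//; apply: diff_derivable; [exact: fA|exact: gA].
Qed.

Lemma Cr_on_sum V W r (A : set V) (I : Type) (s : seq I) (f : I -> V -> W) :
  open A -> (forall i, Cr_on r A (f i)) ->
  Cr_on r A (fun x => \sum_(i <- s) f i x).
Proof.
move=> oA fA; elim: s => [|i s IH].
  by under eq_fun do rewrite big_nil; exact: Cr_on_cst.
by under eq_fun do rewrite big_cons; exact: Cr_on_add.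
Qed.

Lemma Cr_on_scale V W r (A : set V) (a : V -> R) (f : V -> W) : open A ->
  Cr_on r A a -> Cr_on r A f -> Cr_on r A (fun x => a x *: f x).
Proof.
move=> oA; elim: r a f => [|r IH] a f /=.
  by move=> aA fA x Ax; apply: continuousZ; [exact: aA|exact: fA].
move=> [aA DaA] [fA DfA]; split=> [x Ax|v].
  by apply: differentiable_scale; [exact: aA|exact: fA].
apply: (@Cr_on_eq _ _ _ _ (fun x => a x *: 'D_v f x + 'D_v a x *: f x)) => //.
  by move=> x Ax; rewrite derive_scale//; [exact: aA|exact: fA].
by apply: Cr_on_add => //; apply: IH => //; exact: Cr_on_S.
Qed.

Lemma Cr_on_linear V W X r (A : set V) (l : {linear W -> X}) (f : V -> W) :
  open A -> continuous l -> Cr_on r A f -> Cr_on r A (fun x => l (f x)).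
Proof.
move=> oA lc; elim: r f => [|r IH] f /=.
  by move=> fA x Ax; apply: continuous_comp; [exact: fA|exact: lc].
have dl y : differentiable l y by exact: linear_differentiable.
move=> [fA DfA]; split=> [x Ax|v].
  by apply: differentiable_comp => //; exact: fA.
apply: (@Cr_on_eq _ _ _ _ (fun x => l ('D_v f x))) => //; last exact: IH.
by move=> x Ax; rewrite [RHS]derive_comp ?diff_lin//; exact: fA.
Qed.

Lemma Cr_on_id V r (A : set V) : Cr_on r A (fun x : V => x).
Proof.
case: r => [|r] /=; first by move=> x _; exact: cvg_id.
split=> [x _|v].
  exact: differentiable_id.
have -> : 'D_v (fun x : V => x) = fun _ => v by apply/funext => x; exact: derive_id.
exact: Cr_on_cst.
Qed.

Lemma Cr_on_pair V W X r (A : set V) (f : V -> W) (g : V -> X) :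
  open A -> Cr_on r A f -> Cr_on r A g -> Cr_on r A (fun x => (f x, g x)).
Proof.
move=> oA; elim: r f g => [|r IH] f g /=.
  by move=> fA gA x Ax; apply: cvg_pair; [exact: fA|exact: gA].
move=> [fA DfA] [gA DgA]; split=> [x Ax|v].
  by apply: differentiable_pair; [exact: fA|exact: gA].
apply: (@Cr_on_eq _ _ _ _ (fun x => ('D_v f x, 'D_v g x))) => //; last exact: IH.
move=> x Ax; have [dfx dgx] := (fA x Ax, gA x Ax).
by rewrite !deriveE//; [rewrite diff_pair|exact: differentiable_pair].
Qed.

(** A finite spanning family with continuous coefficient forms, which is just what expanding a
    variable direction into fixed ones requires; linear independence is not part of it. *)
Definition findim W : Prop :=
  exists (n : nat) (b : 'I_n -> W) (c : 'I_n -> {linear W -> R}),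
    (forall i, continuous (c i)) /\ forall w, w = \sum_i c i w *: b i.

(** The chain rule differentiates [g] in the direction ['D_v f x], which moves with [x], whereas
    [Cr_on] speaks of fixed directions only. Expanding that direction along the [b i] yields a sum
    of products to which the induction hypothesis applies. *)
Lemma Cr_on_comp V W X r (A : set V) (B : set W) (f : V -> W) (g : W -> X) :
  findim W -> open A -> (forall x, A x -> B (f x)) ->
  Cr_on r A f -> Cr_on r B g -> Cr_on r A (fun x => g (f x)).
Proof.
move=> [n [b [c [cc bc]]]] oA AB; elim: r g => [|r IH] g /=.
  move=> fA gB x Ax; apply: continuous_comp; first exact: fA.
  by apply: gB; exact: AB.
move=> [fA DfA] [gB DgB]; split=> [x Ax|v].
  by apply: differentiable_comp; [exact: fA|apply: gB; exact: AB].
apply: (@Cr_on_eq _ _ _ _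
  (fun x => \sum_i c i ('D_v f x) *: 'D_(b i) g (f x))) => //.
  move=> x Ax; have [dfx dgx] := (fA x Ax, gB _ (AB x Ax)).
  rewrite [RHS]derive_comp// [in RHS](bc ('D_v f x)) linear_sum.
  by apply: eq_bigr => i _; rewrite linearZ/= [in LHS](@deriveE _ _ _ g).
apply: Cr_on_sum => // i; apply: Cr_on_scale => //.
  by apply: Cr_on_linear => //; exact: DfA.
have fA1 : Cr_on r.+1 A f by [].
exact: IH (Cr_on_S fA1) (DgB (b i)).
Qed.

Lemma findim_rV n : findim 'rV[R]_n.
Proof.
exists n, (fun i => delta_mx 0 i).
(* The [i]-th entry as a bundled linear form; [@c] keeps its body visible to the two facts proved
   next. *)
have @c (i : 'I_n) : {linear 'rV[R]_n -> R}.
  by exists (fun N : 'rV[R]_n => N 0 i); do 2![eexists]; do ?[constructor];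
     rewrite ?mxE// => ? *; rewrite ?mxE//; move=> ?; rewrite !mxE.
exists c; split; first by move=> i w; exact: coord_continuous.
by move=> w; exact: row_sum_delta.
Qed.

Lemma findim_R : findim R.
Proof.
exists 1%N, (fun _ => 1), (fun _ => idfun : {linear R -> R}); split.
  by move=> i w; exact: cvg_id.
by move=> w; rewrite big_ord1 [RHS]mulr1.
Qed.

Lemma fst_continuous V W : continuous (@fst V W).
Proof. by move=> p; exact: cvg_fst. Qed.

Lemma snd_continuous V W : continuous (@snd V W).
Proof. by move=> p; exact: cvg_snd. Qed.

Lemma findim_prod V W : findim V -> findim W -> findim (V * W)%type.
Proof.
move=> [n [b [c [cc bc]]]] [m [b' [c' [cc' bc']]]].
exists (n + m)%N, (fun i => match fintype.split i with
  | inl j => (b j, 0) | inr j => (0, b' j) end).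
exists (fun i => match fintype.split i with
  | inl j => (c j \o fst : {linear (V * W)%type -> R})
  | inr j => (c' j \o snd : {linear (V * W)%type -> R}) end).
split.
  move=> i; case: fintype.split => j p /=; apply: continuous_comp.
  - exact: fst_continuous.
  - exact: cc.
  - exact: snd_continuous.
  - exact: cc'.
move=> [v w]; rewrite big_split_ord/=.
under eq_bigr => i _ do rewrite (unsplitK (inl _ i))/=.
under [X in _ + X]eq_bigr => i _ do rewrite (unsplitK (inr _ i))/=.
rewrite [RHS]surjective_pairing !linearD !linear_sum/=.
congr pair.
- rewrite [X in _ + X]big1 ?addr0 => [|i _]; last by rewrite scaler0.
  exact: bc.
- rewrite [X in X + _]big1 ?add0r => [|i _]; last by rewrite scaler0.
  exact: bc'.
Qed.

Lemma findim_linear_continuous V W (l : {linear V -> W}) : findim V ->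
  continuous l.
Proof.
move=> [n [b [c [cc bc]]]].
have -> : (l : V -> W) = fun v => \sum_i c i v *: l (b i).
  by apply/funext => v; rewrite {1}(bc v) linear_sum; apply: eq_bigr => i _;
     rewrite linearZ.
move=> v; apply: (@Cr_on_sum _ _ 0 setT _ (index_enum _)
  (fun i w => c i w *: l (b i))) => //; first exact: openT.
move=> i w _; apply: continuousZ; [exact: cc|exact: cst_continuous].
Qed.

Lemma smooth_onS V W (A B : set V) (f : V -> W) :
  A `<=` B -> smooth_on B f -> smooth_on A f.
Proof. by move=> AB fB r; exact: Cr_onS (fB r). Qed.

Lemma smooth_on_local V W (A : set V) (f : V -> W) :
  (forall x, A x -> exists2 U : set V, U x & smooth_on U f) -> smooth_on A f.
Proof. by move=> Af r; apply: Cr_on_local => x /Af[U Ux fU]; exists U. Qed.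

Lemma smooth_on_eq V W (A : set V) (f g : V -> W) : open A ->
  (forall x, A x -> f x = g x) -> smooth_on A f -> smooth_on A g.
Proof. by move=> oA fg fA r; apply: Cr_on_eq (fA r). Qed.

Lemma smooth_on_cst V W (A : set V) (w : W) : smooth_on A (fun _ : V => w).
Proof. by move=> r; exact: Cr_on_cst. Qed.

Lemma smooth_on_id V (A : set V) : smooth_on A (fun x : V => x).
Proof. by move=> r; exact: Cr_on_id. Qed.

Lemma smooth_on_add V W (A : set V) (f g : V -> W) : open A ->
  smooth_on A f -> smooth_on A g -> smooth_on A (fun x => f x + g x).
Proof. by move=> oA fA gA r; exact: Cr_on_add. Qed.

Lemma smooth_on_sum V W (A : set V) (I : Type) (s : seq I) (f : I -> V -> W) :
  open A -> (forall i, smooth_on A (f i)) ->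
  smooth_on A (fun x => \sum_(i <- s) f i x).
Proof. by move=> oA fA r; apply: Cr_on_sum => // i; exact: fA. Qed.

Lemma smooth_on_scale V W (A : set V) (a : V -> R) (f : V -> W) : open A ->
  smooth_on A a -> smooth_on A f -> smooth_on A (fun x => a x *: f x).
Proof. by move=> oA fA gA r; exact: Cr_on_scale. Qed.

Lemma smooth_on_linear V W X (A : set V) (l : {linear W -> X}) (f : V -> W) :
  open A -> continuous l -> smooth_on A f -> smooth_on A (fun x => l (f x)).
Proof. by move=> oA lc fA r; exact: Cr_on_linear. Qed.

Lemma smooth_on_pair V W X (A : set V) (f : V -> W) (g : V -> X) : open A ->
  smooth_on A f -> smooth_on A g -> smooth_on A (fun x => (f x, g x)).
Proof. by move=> oA fA gA r; exact: Cr_on_pair. Qed.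

Lemma smooth_on_comp V W X (A : set V) (B : set W) (f : V -> W) (g : W -> X) :
  findim W -> open A -> (forall x, A x -> B (f x)) ->
  smooth_on A f -> smooth_on B g -> smooth_on A (fun x => g (f x)).
Proof. by move=> fW oA AB fA gB r; exact: Cr_on_comp (fA r) (gB r). Qed.

Lemma smooth_on_derive V W (A : set V) (f : V -> W) v :
  smooth_on A f -> smooth_on A (fun x => 'D_v f x).
Proof. by move=> fA r; have [_ DfA] := fA r.+1; exact: DfA. Qed.

Lemma smooth_on_differentiable V W (A : set V) (f : V -> W) x :
  smooth_on A f -> A x -> differentiable f x.
Proof. by move=> /(_ 1%N)[+ _]; exact. Qed.

Lemma smooth_on_continuous V W (A : set V) (f : V -> W) x :
  smooth_on A f -> A x -> {for x, continuous f}.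
Proof. by move=> /(_ 0%N); exact. Qed.

End SmoothCalculus.

(** * Partial derivatives, derivatives along lines, and expansions in coordinates *)

Section PartialDerivatives.
Context {R : realType}.
Implicit Types V W X : normedModType R.

Lemma smooth_on_coord (V : normedModType R) l (A : set V) (f : V -> 'rV[R]_l) i :
  open A -> smooth_on A f -> smooth_on A (fun x => f x 0 i : R).
Proof.
move=> oA sf.
have @cl : {linear 'rV[R]_l -> R}.
  by exists (fun N : 'rV[R]_l => N 0 i); do 2![eexists]; do ?[constructor];
     rewrite ?mxE// => ? *; rewrite ?mxE//; move=> ?; rewrite !mxE.
apply: (@smooth_on_linear _ _ _ _ _ cl) => //.
by move=> w; exact: coord_continuous.
Qed.

Lemma is_diff_slicel V W (z : V) (t : W) :
  is_diff z (fun y : V => (y, t)) (fun v => (v, 0)).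
Proof.
have dp : differentiable (fun y : V => (y, t)) z.
  by apply: differentiable_pair; [exact: differentiable_id|exact: differentiable_cst].
apply: DiffDef => //; apply/funext => v.
rewrite diff_pair; [|exact: differentiable_id|exact: differentiable_cst].
rewrite /= -(deriveE _ (differentiable_cst _ _)) -(deriveE _ (differentiable_id _)).
by rewrite derive_cst derive_id.
Qed.

Lemma differentiable_slicel V W X (F : V * W -> X) z t :
  differentiable F (z, t) -> differentiable (fun y => F (y, t)) z.
Proof.
move=> dF; have [dp _] := is_diff_slicel z t.
exact: (@differentiable_comp _ _ _ _ (fun y : V => (y, t)) F).
Qed.

Lemma diff_slicel V W X (F : V * W -> X) z t v : differentiable F (z, t) ->
  'd (fun y => F (y, t)) z v = 'd F (z, t) (v, 0).
Proof.
move=> dF; have [dp dpE] := is_diff_slicel z t.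
rewrite -[fun y => F (y, t)]/(F \o (fun y => (y, t))).
by rewrite diff_comp_eq// dpE.
Qed.

Lemma is_diff_slicer V W (z : V) (t : W) :
  is_diff t (fun y : W => (z, y)) (fun v => (0, v)).
Proof.
have dp : differentiable (fun y : W => (z, y)) t.
  by apply: differentiable_pair; [exact: differentiable_cst|exact: differentiable_id].
apply: DiffDef => //; apply/funext => v.
rewrite diff_pair; [|exact: differentiable_cst|exact: differentiable_id].
rewrite /= -(deriveE _ (differentiable_cst _ _)) -(deriveE _ (differentiable_id _)).
by rewrite derive_cst derive_id.
Qed.

Lemma diff_slicer V W X (F : V * W -> X) z t v : differentiable F (z, t) ->
  'd (fun y => F (z, y)) t v = 'd F (z, t) (0, v).
Proof.
move=> dF; have [dp dpE] := is_diff_slicer z t.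
rewrite -[fun y => F (z, y)]/(F \o (fun y => (z, y))).
by rewrite diff_comp_eq// dpE.
Qed.

Lemma derive_line V W (F : V -> W) (p v : V) :
  differentiable F p -> 'D_1 (fun t : R => F (p + t *: v)) 0 = 'd F p v.
Proof.
move=> dF; have dl : differentiable (fun t : R => p + t *: v) 0.
  apply: differentiableD; first exact: differentiable_cst.
  by apply: differentiable_scale; [exact: differentiable_id|exact: differentiable_cst].
rewrite (derive_comp (f := fun t : R => p + t *: v)) ?scale0r ?addr0//.
congr ('d F p _).
rewrite deriveD; last 2 first.
- exact: derivable_cst.
- apply: diff_derivable.
  by apply: differentiable_scale; [exact: differentiable_id|exact: differentiable_cst].
rewrite derive_cst add0r derive_scale; last 2 first.
- exact: differentiable_id.
- exact: differentiable_cst.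
by rewrite derive_cst scaler0 add0r derive_id scale1r.
Qed.

Lemma derive_rescale W (g : R -> W) (k t : R) :
  differentiable g (k * t) ->
  'D_1 (fun s => g (k * s)) t = k *: 'D_1 g (k * t).
Proof.
move=> dg; have dk : differentiable (fun s : R => k * s) t.
  exact: (differentiableZ _ (differentiable_id t)).
rewrite derive_comp//.
have -> : 'D_1 (fun s : R => k * s) t = k *: (1 : R).
  have -> : (fun s : R => k * s) = k \*: (fun s : R => s) by [].
  by rewrite deriveZ ?derive_id//; exact: derivable_id.
by rewrite linearZ/= deriveE.
Qed.

Lemma open_itvoo (a b : R) : open [set t : R | a < t < b].
Proof.
rewrite (_ : [set t | _] = `]a, b[%classic); first exact: interval_open.
by apply/seteqP; split=> t /=; rewrite in_itv.
Qed.

Lemma smooth_on_rescale (A : set R) k : open A ->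
  smooth_on A (fun s : R => k * s).
Proof.
move=> oA; have := @smooth_on_scale R R R A (fun=> k) (fun s => s) oA.
by apply; [exact: smooth_on_cst|exact: smooth_on_id].
Qed.

Lemma linear_scale (V W : lmodType R) (f : V -> W) k v :
  linear f -> f (k *: v) = k *: f v.
Proof.
move=> lf; have f0 : f 0 = 0.
  by rewrite -[X in f X](addNr v) -scaleN1r lf scaleN1r addNr.
by rewrite -[k *: v]addr0 lf f0 addr0.
Qed.

Lemma linear_add (V W : lmodType R) (f : V -> W) v w :
  linear f -> f (v + w) = f v + f w.
Proof. by move=> lf; rewrite -[v]scale1r lf !scale1r. Qed.

Lemma linear_rV_sum l (X : lmodType R) (f : 'rV[R]_l -> X) v : linear f ->
  f v = \sum_i v 0 i *: f (delta_mx 0 i).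
Proof.
move=> lf; pose g : {linear 'rV[R]_l -> X} :=
  HB.pack f (GRing.isLinear.Build _ _ _ _ f lf).
rewrite -[f]/(g : _ -> _) {1}(row_sum_delta v) linear_sum.
by apply: eq_bigr => i _; rewrite linearZ.
Qed.

(** The partial derivatives on the right are taken in fixed directions, so they vary smoothly with
    [p] when [F] is smooth, and all dependence on the vector sits in scalar coefficients. The limit
    argument treats these two kinds of factor separately. *)
Lemma diff_prod_rV (m k : nat) (W : normedModType R)
    (F : 'rV[R]_m * 'rV[R]_k -> W) p z w : differentiable F p ->
  'd F p (z, w) = \sum_i z 0 i *: 'D_(delta_mx 0 i, 0) F p +
                  \sum_l w 0 l *: 'D_(0, delta_mx 0 l) F p.
Proof.
move=> dF.
have -> : (z, w) = (z, 0) + (0, w).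
  by rewrite [RHS]surjective_pairing/= addr0 add0r.
rewrite linearD; congr (_ + _).
  rewrite (@linear_rV_sum _ _ (fun z => 'd F p (z, 0))).
    by apply: eq_bigr => i _; rewrite deriveE.
  move=> c v v'; rewrite -linearP; congr ('d F p _).
  by rewrite [RHS]surjective_pairing/= scaler0 addr0.
rewrite (@linear_rV_sum _ _ (fun w => 'd F p (0, w))).
  by apply: eq_bigr => i _; rewrite deriveE.
move=> c v v'; rewrite -linearP; congr ('d F p _).
by rewrite [RHS]surjective_pairing/= scaler0 addr0.
Qed.

End PartialDerivatives.

(** * Smooth maps between manifolds *)

Section SmoothMaps.
Context {R : realType}.
Implicit Types V W : normedModType R.

Lemma chinvK n (M : manifold R n) i z : (chart M i @` dom M i) z ->
  chart M i (chinv M i z) = z.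
Proof. by move=> [p pi <-]; rewrite chartK. Qed.

Lemma dom_chinv n (M : manifold R n) i z : (chart M i @` dom M i) z ->
  dom M i (chinv M i z).
Proof. by move=> [p pi <-]; rewrite chartK. Qed.

Lemma chart_imageE n (M : manifold R n) i (A : set M) :
  chart M i @` (dom M i `&` A) =
  (chart M i @` dom M i) `&` chinv M i @^-1` A.
Proof.
apply/seteqP; split=> [z [p [pi Ap] <-]|z [zi Az]].
  by split; [exists p|rewrite /preimage/= chartK].
by exists (chinv M i z); [split=> //; exact: dom_chinv|exact: chinvK].
Qed.

Lemma open_chart_image n (M : manifold R n) i (A : set M) :
  open A -> open (chart M i @` (dom M i `&` A)).
Proof.
move=> oA; rewrite chart_imageE; apply: open_preimage => //.
  exact: cod_open.
by move=> z; exact: chinv_continuous.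
Qed.

Lemma near_dom n (M : manifold R n) i p : dom M i p ->
  \forall q \near p, dom M i q.
Proof. by move=> pi; apply: open_nbhs_nbhs; split=> //; exact: dom_open. Qed.

Lemma near_chart_image n (M : manifold R n) i p : dom M i p ->
  \forall z \near chart M i p, (chart M i @` dom M i) z.
Proof.
by move=> pi; apply: open_nbhs_nbhs; split; [exact: cod_open|exists p].
Qed.

Lemma near_chinv n (M : manifold R n) i p (P : M -> Prop) : dom M i p ->
  (\forall q \near p, P q) -> \forall z \near chart M i p, P (chinv M i z).
Proof.
move=> pi Pp; apply: (@chinv_continuous _ _ M i (chart M i p)).
  by exists p.
by rewrite chartK.
Qed.

Lemma smooth_intoS V n (M : manifold R n) (A B : set V) (f : V -> M) :
  A `<=` B -> smooth_into B f -> smooth_into A f.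
Proof.
move=> AB [fc fs]; split=> [x /AB|a]; first exact: fc.
by apply: smooth_onS (fs a) => x [/AB].
Qed.

Lemma smooth_into_local V n (M : manifold R n) (A : set V) (f : V -> M) :
  (forall x, A x -> exists2 U : set V, U x & smooth_into U f) ->
  smooth_into A f.
Proof.
move=> Af; split=> [x /Af[U Ux [fc _]]|a]; first exact: fc.
by apply: smooth_on_local => x [/Af[U Ux [_ fs]] ax]; exists (U `&` f @^-1` dom M a).
Qed.

Lemma smooth_into_eq V n (M : manifold R n) (A : set V) (f g : V -> M) :
  open A -> (forall x, A x -> f x = g x) -> smooth_into A f -> smooth_into A g.
Proof.
move=> oA fg [fc fs].
have gc x : A x -> {for x, continuous g}.
  move=> Ax; have fgx : \forall y \near x, f y = g y by exact: near_open fg.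
  rewrite /prop_for /continuous_at -fg//; apply: cvg_trans (fc x Ax).
  exact: near_eq_cvg.
split=> // a; apply: (@smooth_on_eq _ _ _ _ (chart M a \o f)).
- by apply: open_preimage => //; exact: dom_open.
- by move=> x [Ax _] /=; rewrite fg.
- by apply: smooth_onS (fs a) => x [Ax]; rewrite /preimage/= fg.
Qed.

Lemma smooth_into_precomp V W n (M : manifold R n) (A : set V) (B : set W)
    (h : V -> W) (f : W -> M) : findim W -> open A ->
  (forall x, A x -> B (h x)) -> smooth_on A h -> smooth_into B f ->
  smooth_into A (fun x => f (h x)).
Proof.
move=> fW oA AB hs [fc fs].
have fhc x : A x -> {for x, continuous (fun x => f (h x))}.
  move=> Ax; apply: continuous_comp; first exact: smooth_on_continuous hs Ax.
  by apply: fc; exact: AB.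
split=> // a.
apply: (@smooth_on_comp _ _ _ _ _ (B `&` f @^-1` dom M a) h (chart M a \o f)) => //.
- by apply: open_preimage => //; exact: dom_open.
- by move=> x [/AB].
- by apply: smooth_onS hs => x [].
Qed.

Lemma smooth_into_chinv n (M : manifold R n) i :
  smooth_into (chart M i @` dom M i) (chinv M i).
Proof.
split=> [z|a]; first exact: chinv_continuous.
by rewrite -chart_imageE; exact: transition_smooth.
Qed.

Lemma smooth_fun_chart n (M : manifold R n) i : smooth_fun (dom M i) (chart M i).
Proof. by move=> a; exact: transition_smooth. Qed.

Lemma smooth_on_into V W n (M : manifold R n) (A : set V) (B : set M)
    (f : V -> M) (h : M -> W) : open A -> open B ->
  (forall x, A x -> B (f x)) -> smooth_into A f -> smooth_fun B h ->
  smooth_on A (fun x => h (f x)).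
Proof.
move=> oA oB AB [fc fs] hs; apply: smooth_on_local => x Ax.
set a := at_ M (f x).
have oU : open (A `&` f @^-1` dom M a).
  by apply: open_preimage => //; exact: dom_open.
exists (A `&` f @^-1` dom M a); first by split=> //; exact: dom_at.
apply: (@smooth_on_eq _ _ _ _ (fun x => (h \o chinv M a) (chart M a (f x)))) => //.
  by move=> y [Ay ay] /=; rewrite chartK.
apply: smooth_on_comp (hs a) => //; first exact: findim_rV.
by move=> y [Ay ay]; exists (f y) => //; split=> //; exact: AB.
Qed.

Lemma smooth_into_map V n m (M : manifold R n) (X : manifold R m) (A : set V)
    (B : set M) (f : V -> M) (h : M -> X) : open A -> open B ->
  (forall x, A x -> B (f x)) -> smooth_into A f -> smooth_map B h ->
  smooth_into A (fun x => h (f x)).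
Proof.
move=> oA oB AB [fc fs] hs; apply: smooth_into_local => x Ax.
set a := at_ M (f x).
have oU : open (A `&` f @^-1` dom M a).
  by apply: open_preimage => //; exact: dom_open.
exists (A `&` f @^-1` dom M a); first by split=> //; exact: dom_at.
apply: (@smooth_into_eq _ _ _ _ (fun x => (h \o chinv M a) (chart M a (f x)))) => //.
  by move=> y [Ay ay] /=; rewrite chartK.
apply: smooth_into_precomp (hs a) => //; first exact: findim_rV.
by move=> y [Ay ay]; exists (f y) => //; split=> //; exact: AB.
Qed.

Lemma smooth_fun_comp l m (X : manifold R l) (Y : manifold R m) W
    (A : set X) (B : set Y) (f : X -> Y) (h : Y -> W) :
  open A -> open B -> (forall x, A x -> B (f x)) -> smooth_map A f ->
  smooth_fun B h -> smooth_fun A (h \o f).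
Proof.
move=> oA oB AB fs hs i; apply: smooth_on_into (fs i) hs => //.
  exact: open_chart_image.
by rewrite chart_imageE => x [_ /AB].
Qed.

(** Continuity is a separate clause because the chart expression has arbitrary values where [f]
    leaves the chart domain, so its differentiability alone does not keep nearby points inside
    [dom M a]. *)
Definition mdifferentiable m n (X : manifold R m) (M : manifold R n)
    (f : X -> M) (x : X) : Prop :=
  {for x, continuous f} /\ forall i a, dom X i x -> dom M a (f x) ->
    differentiable (chart M a \o f \o chinv X i) (chart X i x).

Lemma mdifferentiable_smooth m n (X : manifold R m) (M : manifold R n)
    (A : set X) (f : X -> M) x : open A -> A x -> smooth_map A f ->
  mdifferentiable f x.
Proof.
move=> oA Ax fs; split.
  pose i := at_ X x; have xi : dom X i x := dom_at x.
  have [fc _] := fs i.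
  have fcx : {for x, continuous ((f \o chinv X i) \o chart X i)}.
    apply: continuous_comp; first exact: chart_continuous.
    by apply: fc; exists x.
  have E : {near x, (f \o chinv X i) \o chart X i =1 f}.
    by near=> y; rewrite /= chartK//; near: y; exact: near_dom.
  rewrite /prop_for /continuous_at -(nbhs_singleton E).
  by apply: cvg_trans fcx; exact: near_eq_cvg.
move=> i a xi ax; have [_ /(_ a) fa] := fs i.
by apply: smooth_on_differentiable fa _; split;
  [exists x|rewrite /preimage/= chartK].
Unshelve. all: by end_near. Qed.

Lemma mdifferentiable_id m (X : manifold R m) (x : X) :
  mdifferentiable (fun y : X => y) x.
Proof.
split=> [|i a xi xa]; first exact: cvg_id.
apply: smooth_on_differentiable (@transition_smooth _ _ X i a) _.
by exists x.
Qed.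

Section ChainRule.
Context l m n (X : manifold R l) (Y : manifold R m) (Z : manifold R n).
Variables (f : X -> Y) (h : Y -> Z) (x : X).
Hypotheses (df : mdifferentiable f x) (dh : mdifferentiable h (f x)).

Lemma near_chart_comp i a b : dom X i x -> dom Y a (f x) -> dom Z b (h (f x)) ->
  \forall z \near chart X i x,
    ((chart Z b \o h \o chinv Y a) \o (chart Y a \o f \o chinv X i)) z =
    (chart Z b \o (h \o f) \o chinv X i) z.
Proof.
move=> xi ya _; have [fc _] := df.
have fya : \forall y \near x, dom Y a (f y) by exact/fc/near_dom.
by move: (near_chinv xi fya); apply: filterS => z az /=; rewrite chartK.
Qed.

Lemma differentiable_chart_comp i a b :
  dom X i x -> dom Y a (f x) -> dom Z b (h (f x)) ->
  differentiable ((chart Z b \o h \o chinv Y a) \o (chart Y a \o f \o chinv X i))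
    (chart X i x).
Proof.
move=> xi ya zb; have [[_ df'] [_ dh']] := (df, dh).
apply: differentiable_comp; first exact: df'.
by rewrite /= chartK//; exact: dh'.
Qed.

Lemma mdifferentiable_comp : mdifferentiable (h \o f) x.
Proof.
split; first by apply: continuous_comp; [exact: df.1|exact: dh.1].
move=> i b xi zb; have ya := @dom_at _ _ Y (f x).
exact: differentiable_near (near_chart_comp xi ya zb)
  (differentiable_chart_comp xi ya zb).
Qed.

(** The chain rule with all three charts free. Preferred charts give functoriality of [tmap]; an
    identity map in one or both places gives the change-of-chart formulas for [coord] and [vec]. *)
Lemma diff_chart_comp i a b v :
  dom X i x -> dom Y a (f x) -> dom Z b (h (f x)) ->
  'd (chart Z b \o (h \o f) \o chinv X i) (chart X i x) v =
  'd (chart Z b \o h \o chinv Y a) (chart Y a (f x))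
    ('d (chart Y a \o f \o chinv X i) (chart X i x) v).
Proof.
move=> xi ya zb; have [[_ df'] [_ dh']] := (df, dh).
rewrite -(diff_near v (near_chart_comp xi ya zb)); last first.
  exact: differentiable_chart_comp.
rewrite diff_comp_eq/= ?chartK//; first exact: df'.
exact: dh'.
Qed.

Lemma tmap_comp v : tmap (h \o f) x v = tmap h (f x) (tmap f x v).
Proof. by apply: diff_chart_comp; exact: dom_at. Qed.

End ChainRule.

Lemma coord_tmap m n (X : manifold R m) (M : manifold R n) (f : X -> M) x a v :
  mdifferentiable f x -> dom M a (f x) -> coord a (f x) (tmap f x v) =
    'd (chart M a \o f \o chinv X (at_ X x)) (chart X (at_ X x) x) v.
Proof.
move=> df ya; symmetry.
apply: (@diff_chart_comp _ _ _ _ _ _ f id) => //; try exact: dom_at.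
exact: mdifferentiable_id.
Qed.

Lemma diff_chartK n (M : manifold R n) i p v : dom M i p ->
  'd (chart M i \o chinv M i) (chart M i p) v = v.
Proof.
move=> pi; rewrite -(@diff_near _ _ _ (fun y => y)).
- by rewrite -deriveE; [exact: derive_id|exact: differentiable_id].
- by apply: filterS (near_chart_image pi) => z zi /=; rewrite chinvK.
- exact: differentiable_id.
Qed.

Lemma coord_at n (M : manifold R n) p v : coord (at_ M p) p v = v.
Proof. by apply: diff_chartK; exact: dom_at. Qed.

Lemma coordK n (M : manifold R n) i (p : M) v : dom M i p ->
  vec i p (coord i p v) = v.
Proof.
move=> pi; rewrite -[RHS](diff_chartK v (dom_at p)); symmetry.
apply: (@diff_chart_comp _ _ _ _ _ _ id id) => //; try exact: dom_at.
all: exact: mdifferentiable_id.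
Qed.

Lemma coord_vec n (M : manifold R n) i j (p : M) v : dom M i p -> dom M j p ->
  coord j p (vec i p v) =
    'd (chart M j \o chinv M i) (chart M i p) v.
Proof.
move=> pi pj; symmetry.
apply: (@diff_chart_comp _ _ _ _ _ _ id id) => //; try exact: dom_at.
all: exact: mdifferentiable_id.
Qed.

Lemma tmap_near m n (X : manifold R m) (M : manifold R n) (f g : X -> M) x v :
  (\forall y \near x, f y = g y) -> mdifferentiable f x ->
  tmap f x v = tmap g x v.
Proof.
move=> fg [_ df]; rewrite /tmap -(nbhs_singleton fg).
apply: diff_near; last by apply: df; exact: dom_at.
by move: (near_chinv (dom_at x) fg); apply: filterS => z /= ->.
Qed.

Lemma tmap_id m (X : manifold R m) (x : X) v : tmap (fun y : X => y) x v = v.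
Proof. exact: coord_at. Qed.

Lemma coord_linear n (M : manifold R n) i (p : M) : linear (coord i p).
Proof. exact: linearP. Qed.

Lemma vec_linear n (M : manifold R n) i (p : M) : linear (vec i p).
Proof. exact: linearP. Qed.

Lemma tmap_linear m n (X : manifold R m) (M : manifold R n) (f : X -> M) x :
  linear (tmap f x).
Proof. exact: linearP. Qed.

Lemma coordD n (M : manifold R n) i (p : M) v w :
  coord i p (v + w) = coord i p v + coord i p w.
Proof. exact: linear_add (coord_linear _ _). Qed.

Lemma coordZ n (M : manifold R n) i (p : M) c v :
  coord i p (c *: v) = c *: coord i p v.
Proof. exact: linear_scale (coord_linear _ _). Qed.

Lemma tmapD m n (X : manifold R m) (M : manifold R n) (f : X -> M) x v w :
  tmap f x (v + w) = tmap f x v + tmap f x w.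
Proof. exact: linear_add (tmap_linear _ _). Qed.

Lemma tmapZ m n (X : manifold R m) (M : manifold R n) (f : X -> M) x c v :
  tmap f x (c *: v) = c *: tmap f x v.
Proof. exact: linear_scale (tmap_linear _ _). Qed.

End SmoothMaps.

(** * Geodesics and vector bundles *)

Section Geodesics.
Context {R : realType}.

Variables (n : nat) (M : manifold R n).

(** The axioms of a connection apply to smooth fields only, and the geodesic equation uses the field
    with constant coordinates in a chart. In another chart that field is a directional derivative of
    the transition map. *)
Lemma smooth_along_vec a w : smooth_along (dom M a) id (fun q => vec a q w).
Proof.
move=> i b; set A := (X in smooth_on X _).
have oA : open A.
  rewrite /A -setIA.
  by apply: open_chart_image; apply: openI; exact: dom_open.
have AP z : A z -> [/\ (chart M i @` dom M i) z, dom M i (chinv M i z),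
    dom M a (chinv M i z) & dom M b (chinv M i z)].
  by rewrite /A -setIA chart_imageE => -[zi [az bz]]; split=> //; exact: dom_chinv.
apply: (@smooth_on_eq _ _ _ _ (fun z =>
    'D_w (chart M b \o chinv M a) ((chart M a \o chinv M i) z))) => //.
  move=> z /AP[zi iz az bz]; rewrite coord_vec//= deriveE//.
  apply: smooth_on_differentiable (@transition_smooth _ _ M a b) _.
  by exists (chinv M i z).
apply: smooth_on_comp (smooth_on_derive w (@transition_smooth _ _ M a b)) => //.
- exact: findim_rV.
- by move=> z /AP[zi iz az bz]; exists (chinv M i z).
- apply: smooth_onS (@transition_smooth _ _ M i a) => z /AP[zi iz az bz].
  by exists (chinv M i z) => //; rewrite chinvK.
Qed.

(** One factor [k] comes from the Leibniz rule with a constant function, whose derivative vanishes,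
    the other from linearity in the direction. *)
Lemma connectionZ (D : connection M) (A : set M) Y p k v : open A -> A p ->
  smooth_along A id Y ->
  D (fun q => k *: Y q) p (k *: v) = k *: (k *: D Y p v).
Proof.
move=> oA Ap sY.
have sk : smooth_fun A (fun _ : M => k) by move=> i; exact: smooth_on_cst.
rewrite (@nabla_leibniz _ _ _ D A (fun=> k) Y p (k *: v) oA Ap sk sY).
rewrite (linear_scale _ _ (@nabla_linear _ _ _ D _ _ _ oA Ap sY)).
have -> : (fun _ : M => k) \o chinv M (at_ M p) = cst k by [].
by rewrite diff_cst scale0r addr0.
Qed.

(** Both terms of the geodesic equation are homogeneous of degree two under a linear change of time:
    the second derivative by the chain rule, the connection term by [connectionZ]. *)
Lemma geodesic_rescale (D : connection M) (l r l' r' k : R) (c : R -> M) :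
  (forall s, l' < s < r' -> l < k * s < r) -> geodesic D l r c ->
  geodesic D l' r' (fun s => c (k * s)).
Proof.
move=> lr [cs cg].
have sk := smooth_on_rescale k (@open_itvoo _ l' r').
split.
  apply: smooth_into_precomp cs => //; first exact: findim_R.
  exact: open_itvoo.
move=> t lt a g; have /cg /= := lr t lt; rewrite -/a.
set g0 := chart M a \o c => E.
pose A := [set s : R | l < s < r] `&` c @^-1` dom M a.
have oA : open A.
  by apply: open_preimage cs.1; [exact: open_itvoo|exact: dom_open].
have gs : smooth_on A g0 := cs.2 a.
have dgs : smooth_on A (fun s => 'D_1 g0 s) by exact: smooth_on_derive.
have kt : A (k * t) by split; [exact: lr|exact: dom_at].
have At : \forall s \near t, A (k * s).
  have kc : {for t, continuous (fun s : R => k * s)}.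
    exact: smooth_on_continuous sk lt.
  by apply: kc; exact: open_nbhs_nbhs.
have d1 s : A (k * s) -> 'D_1 g s = k *: 'D_1 g0 (k * s).
  move=> As; rewrite -derive_rescale//.
  exact: smooth_on_differentiable gs As.
have d2 : 'D_1 (fun s => 'D_1 g s) t = k *: (k *: 'D_1 (fun s => 'D_1 g0 s) (k * t)).
  rewrite -derive_rescale; last first.
    exact: smooth_on_differentiable dgs kt.
  rewrite -deriveZ; last first.
    apply: diff_derivable.
    apply: (@differentiable_comp _ _ _ _ (fun s : R => k * s) (fun s => 'D_1 g0 s)).
      exact: smooth_on_differentiable sk lt.
    exact: smooth_on_differentiable dgs kt.
  by apply: near_eq_derive; apply: filterS At => s; exact: d1.
rewrite d2 d1//.
rewrite (_ : (fun q => vec a q (k *: 'D_1 g0 (k * t))) =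
             (fun q => k *: vec a q ('D_1 g0 (k * t)))); last first.
  by apply/funext => q; rewrite /vec linearZ.
have oa := @dom_open _ _ M a.
rewrite (connectionZ D _ _ oa (dom_at _) (smooth_along_vec a _)).
by rewrite -!scalerDr E !scaler0.
Qed.

Lemma velocity_near (c c' : R -> M) t : (\forall s \near t, c s = c' s) ->
  velocity c t = velocity c' t.
Proof.
move=> cc'; rewrite /velocity -(nbhs_singleton cc').
by apply: near_eq_derive; apply: filterS cc' => s /= ->.
Qed.

Lemma velocity_rescale (A : set R) (c : R -> M) k : open A -> A 0 ->
  smooth_into A c -> velocity (fun s => c (k * s)) 0 = k *: velocity c 0.
Proof.
move=> oA A0 [_ cs]; rewrite /velocity mulr0.
rewrite (derive_rescale (g := chart M (at_ M (c 0)) \o c)) mulr0//.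
apply: smooth_on_differentiable (cs _) _; split=> //; exact: dom_at.
Qed.

End Geodesics.

Section VectorBundles.
Context {R : realType} {m k : nat} {B : manifold R m}.
Implicit Type N : vbundle B k.

Definition trivialization N (V : set B) (h : N -> 'rV[R]_k)
    (g : B -> 'rV[R]_k -> N) : Prop :=
  [/\ open V,
      forall x w, V x -> proj N (g x w) = x /\ h (g x w) = w,
      forall e, V (proj N e) -> g (proj N e) (h e) = e,
      smooth_fun (proj N @^-1` V) h /\
      (forall i, @smooth_into R ('rV[R]_m * 'rV[R]_k)%type _ N
        ((chart B i @` (dom B i `&` V)) `*` setT)
        (fun zw => g (chinv B i zw.1) zw.2)) &
      forall x, V x ->
        [/\ fzero N x = g x 0,
            forall w w', fadd N (g x w) (g x w') = g x (w + w') &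
            forall c w, fscal N c (g x w) = g x (c *: w)]].

Lemma trivialization_at N (x : B) : exists V h g,
  trivialization (N := N) V h g /\ V x.
Proof.
have [V [h [g [[oV Vx] a b c d]]]] := @local_trivial _ _ _ _ N x.
by exists V, h, g.
Qed.

Section Trivialization.
Variables (N : vbundle B k) (V : set B) (h : N -> 'rV[R]_k)
  (g : B -> 'rV[R]_k -> N).
Hypothesis tr : trivialization V h g.

Lemma triv_open : open V. Proof. by case: tr. Qed.

Lemma triv_proj x w : V x -> proj N (g x w) = x.
Proof. by move=> Vx; have [_ gP _ _ _] := tr; exact: (gP x w Vx).1. Qed.

Lemma trivK x w : V x -> h (g x w) = w.
Proof. by move=> Vx; have [_ gP _ _ _] := tr; exact: (gP x w Vx).2. Qed.

Lemma triv_inv e : V (proj N e) -> g (proj N e) (h e) = e.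
Proof. by case: tr => _ _ + _ _; apply. Qed.

Lemma triv_zero x : V x -> fzero N x = g x 0.
Proof. by case: tr => _ _ _ _ + Vx => /(_ x Vx)[]. Qed.

Lemma triv_add e e' : V (proj N e) -> proj N e' = proj N e ->
  fadd N e e' = g (proj N e) (h e + h e').
Proof.
move=> Ve ee'; have [_ _ _ _ /(_ _ Ve)[_ <- _]] := tr.
by rewrite triv_inv// -[in g _ (h e')]ee' triv_inv// ee'.
Qed.

Lemma triv_scal c e : V (proj N e) -> fscal N c e = g (proj N e) (c *: h e).
Proof.
by move=> Ve; have [_ _ _ _ /(_ _ Ve)[_ _ <-]] := tr; rewrite triv_inv.
Qed.

Lemma open_triv_preimage : open (proj N @^-1` V).
Proof.
rewrite -[X in open X]setTI; apply: open_preimage.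
- exact: openT.
- exact: triv_open.
- move=> e _.
  exact: (mdifferentiable_smooth (x := e) openT I (@proj_smooth _ _ _ _ N)).1.
Qed.

End Trivialization.

Lemma proj_fscal N c e : proj N (fscal N c e) = proj N e.
Proof.
have [V [h [g [tr Ve]]]] := trivialization_at N (proj N e).
by rewrite (triv_scal tr)// (triv_proj tr).
Qed.

Lemma fscal_fscal N a b e : fscal N a (fscal N b e) = fscal N (a * b) e.
Proof.
have [V [h [g [tr Ve]]]] := trivialization_at N (proj N e).
rewrite (triv_scal tr) ?proj_fscal// !(triv_scal tr)//.
by rewrite (trivK tr)// scalerA.
Qed.

Lemma fscal1 N e : fscal N 1 e = e.
Proof.
have [V [h [g [tr Ve]]]] := trivialization_at N (proj N e).
by rewrite (triv_scal tr)// scale1r (triv_inv tr).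
Qed.

Lemma fscal0 N e : fscal N 0 e = fzero N (proj N e).
Proof.
have [V [h [g [tr Ve]]]] := trivialization_at N (proj N e).
by rewrite (triv_scal tr)// scale0r (triv_zero tr).
Qed.

Lemma proj_fzero N x : proj N (fzero N x) = x.
Proof.
have [V [h [g [tr Vx]]]] := trivialization_at N x.
by rewrite (triv_zero tr)// (triv_proj tr).
Qed.

Lemma smooth_into_proj (V : normedModType R) N (A : set V) (F : V -> N) :
  open A -> smooth_into A F -> smooth_into A (fun v => proj N (F v)).
Proof.
move=> oA sF; apply: smooth_into_map sF (@proj_smooth _ _ _ _ N) => //.
exact: openT.
Qed.

(** The bundle record does not postulate that fiberwise scaling is smooth. It follows locally, since
    in a trivialization scaling is multiplication of the fiber coordinate by the scalar. *)
Lemma smooth_into_fscal (X : normedModType R) N (A : set X) (c : X -> R)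
    (F : X -> N) : open A -> smooth_on A c -> smooth_into A F ->
  smooth_into A (fun v => fscal N (c v) (F v)).
Proof.
move=> oA sc sF; apply: smooth_into_local => v Av.
have [V [h [g [tr Vv]]]] := trivialization_at N (proj N (F v)).
have sP := smooth_into_proj oA sF.
pose i := at_ B (proj N (F v)).
have oiV : open (dom B i `&` V).
  by apply: openI; [exact: dom_open|exact: triv_open tr].
pose U := A `&` (fun v => proj N (F v)) @^-1` (dom B i `&` V).
have oU : open U by apply: open_preimage => //; exact: sP.1.
exists U; first by split=> //; split=> //; exact: dom_at.
apply: (@smooth_into_eq _ _ _ _ _ (fun v =>
    (fun zw => g (chinv B i zw.1) zw.2)
    (chart B i (proj N (F v)), c v *: h (F v)))) => //.
  by move=> y [Ay [iy Vy]] /=; rewrite chartK// (triv_scal tr).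
have [_ _ _ [sh /(_ i) sg] _] := tr.
apply: smooth_into_precomp sg => //.
- by apply: findim_prod; exact: findim_rV.
- by move=> y [Ay [iy Vy]]; split=> //=; exists (proj N (F y)).
apply: smooth_on_pair => //.
- apply: (@smooth_on_into _ _ _ _ _ _ (dom B i) (fun v => proj N (F v))) => //.
  + exact: dom_open.
  + by move=> y [Ay []].
  + by apply: smooth_intoS sP => y [].
  + exact: smooth_fun_chart.
- apply: smooth_on_scale => //; first by apply: smooth_onS sc => y [].
  apply: smooth_on_into sh => //; first exact: open_triv_preimage tr.
  + by move=> y [Ay []].
  + by apply: smooth_intoS sF => y [].
Qed.

Lemma smooth_fscal N c : smooth_map setT (fscal N c).
Proof.
move=> i; rewrite chart_imageE setIT; apply: smooth_into_fscal.
- exact: cod_open.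
- exact: smooth_on_cst.
- exact: smooth_into_chinv.
Qed.

Lemma fscal_line_continuous N (e : N) t :
  {for t, continuous (fun c => fscal N c e)}.
Proof.
have [+ _] : smooth_into (setT : set R) (fun c => fscal N c e); last exact.
apply: smooth_into_fscal; [exact: openT|exact: smooth_on_id|].
by split=> [x _|a]; [exact: cst_continuous|exact: smooth_on_cst].
Qed.

End VectorBundles.

(** * The exponential map and smooth families *)

Section ExponentialMap.
Context {R : realType} {m n k : nat} {M : manifold R n} {S : manifold R m}.
Variables (J : almost_complex M) (u : S -> M) (N : vbundle S k).
Variables (pi : S -> 'rV[R]_n -> N) (s : N -> 'rV[R]_n) (D : connection M).
Variables (W : set N) (phi : N -> M).
Hypotheses (s_complement : invariant_complement J u pi s).
Hypotheses (phi_exp : exponential_map u s D W phi).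

Lemma near_fscal_domain e : \forall t \near (0 : R), W (fscal N t e).
Proof.
have [[oW W0] _ _ _ _] := phi_exp.
apply: (@fscal_line_continuous _ _ _ _ N e 0).
by rewrite fscal0; exact: open_nbhs_nbhs.
Qed.

(** [is_exp] describes [phi] only through time-1 values of different geodesics. Rescaling time makes
    them all values of one geodesic, so [phi] along a ray can be differentiated. *)
Lemma exponential_near_geodesic e : W e -> exists c : R -> M,
  [/\ exists2 A : set R, open A /\ A 0 & smooth_into A c,
      c 0 = u (proj N e), velocity c 0 = s e &
      \forall t \near (0 : R), phi (fscal N t e) = c t].
Proof.
have [_ _ sZ _ _] := s_complement.
have [_ Wexp _ _ _] := phi_exp.
move=> We; have [[l [r [c [l0 r1 cg c0 vc]]]] _] := Wexp e We.
have A0 : l < 0 < r by rewrite l0 (lt_trans ltr01).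
exists c; split=> //.
  exists [set t | l < t < r]; last exact: cg.1.
  by split=> //; exact: open_itvoo.
(* The rescaled geodesic is used on times [x] in ]-1, 2[. There [|t| < d] gives
   [|t * x| < min (- l) 1], which keeps [t * x] between [l] and [1 < r]. *)
pose d := Num.min (- l) 1 / 2.
have d0 : 0 < d by rewrite divr_gt0// lt_min oppr_gt0 l0 ltr01.
have nd : \forall t \near (0 : R), `|t| < d.
  by apply/nbhs_ballP; exists d => // t; rewrite /ball/= sub0r normrN.
near=> t.
have td : `|t| < d by near: t.
have Wt : W (fscal N t e) by near: t; exact: near_fscal_domain.
(* [c (t * _)] has initial velocity [t *: s e], hence [phi (t e) = c t]. *)
have [_ /(_ (-1) 2 (fun x => c (t * x)))] := Wexp _ Wt.
rewrite mulr1 mulr0 proj_fscal sZ -vc => <-//; split => //.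
- by rewrite ltr1n.
- apply: geodesic_rescale cg => x /andP[x1 x2].
  have : `|t * x| < Num.min (- l) 1.
    rewrite normrM (@le_lt_trans _ _ (`|t| * 2))//.
      rewrite ler_wpM2l// ler_norml (ltW x2) andbT.
      by rewrite (le_trans _ (ltW x1))// lerN2 ler1n.
    by rewrite -ltr_pdivlMr.
  rewrite lt_min => /andP[]; rewrite ltr_norml opprK => /andP[-> _]/=.
  by rewrite ltr_norml => /andP[_ /lt_trans]; apply.
- by rewrite (velocity_rescale t (open_itvoo (a:=l) (b:=r)) A0 cg.1).
Unshelve. all: by end_near. Qed.

(** The vector [e] may lie outside [W], but a small multiple of it does not. The geodesic of that
    multiple is followed and time is rescaled back, which restores the velocity [s e]. *)
Lemma exponential_ray e : phi (fzero N (proj N e)) = u (proj N e) /\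
  velocity (fun t => phi (fscal N t e)) 0 = s e.
Proof.
have [_ _ sZ _ _] := s_complement.
have /nbhs_ballP[r /= r0 rW] := near_fscal_domain e.
have r20 : 0 < r / 2 by rewrite divr_gt0.
have We0 : W (fscal N (r / 2) e).
  apply: rW; rewrite /ball/= sub0r normrN gtr0_norm// ltr_pdivrMr//.
  by rewrite ltr_pMr// ltr1n.
have [c [[A [oA A0] cs] c0 vc phic]] := exponential_near_geodesic We0.
split.
  by have := nbhs_singleton phic; rewrite fscal0 proj_fscal c0 proj_fscal.
rewrite (@velocity_near _ _ _ _ (fun t => c ((r / 2)^-1 * t))).
  rewrite (velocity_rescale _ oA A0 cs) vc sZ scalerA mulVf ?scale1r//.
  by rewrite gt_eqF.
have kc : {for 0, continuous (fun t : R => (r / 2)^-1 * t)}.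
  exact: smooth_on_continuous (smooth_on_rescale _ openT) I.
have phic' : \forall t \near ((r / 2)^-1 * 0),
    phi (fscal N t (fscal N (r / 2) e)) = c t by rewrite mulr0.
have : \forall t \near (0 : R), phi (fscal N ((r / 2)^-1 * t) (fscal N (r / 2) e)) =
    c ((r / 2)^-1 * t) := kc _ phic'.
apply: filterS => t; rewrite fscal_fscal mulrAC mulVf ?mul1r//.
by rewrite gt_eqF.
Qed.

Lemma pullback_acsP e v : W e ->
  tmap phi e (pullback_acs J phi e v) = J (phi e) (tmap phi e v).
Proof.
have [[oW _] _ phis [oP _] [psi psis psiK]] := phi_exp.
move=> We; rewrite /pullback_acs.
apply: (@getPex _ [set w | tmap phi e w = J (phi e) (tmap phi e v)]).
have Pe : (phi @` W) (phi e) by exists e.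
have dpsi := mdifferentiable_smooth oP Pe psis.
have dphi : mdifferentiable phi (psi (phi e)).
  by rewrite psiK//; exact: mdifferentiable_smooth oW We phis.
exists (tmap psi (phi e) (J (phi e) (tmap phi e v))) => /=.
rewrite -[in tmap phi e](psiK e We) -(tmap_comp dpsi dphi).
rewrite -[RHS](tmap_id (phi e)); apply: tmap_near.
  have : \forall q \near phi e, (phi @` W) q by exact: open_nbhs_nbhs.
  by apply: filterS => q [e' We' <-] /=; rewrite psiK.
exact: mdifferentiable_comp.
Qed.

End ExponentialMap.

Section Families.
Context {R : realType} {m n k : nat} {M : manifold R n} {S : manifold R m}.
Variable N : vbundle S k.

Lemma smooth_into_fscal_section (nu : S -> N) (A : set R) i :
  open A -> smooth_map setT nu ->
  @smooth_into R (R * 'rV[R]_m)%type _ N (A `*` (chart S i @` dom S i))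
    (fun tz => fscal N tz.1 (nu (chinv S i tz.2))).
Proof.
move=> oA nus.
have oAU : open (A `*` (chart S i @` dom S i)).
  by apply: open_setX => //; exact: cod_open.
apply: smooth_into_fscal => //.
  apply: (@smooth_on_linear _ _ _ _ _ fst id) => //.
  - by move=> p; exact: fst_continuous.
  - exact: smooth_on_id.
have := nus i; rewrite chart_imageE setIT => nusi.
apply: (@smooth_into_precomp _ _ _ _ _ _ _ snd _ _ _ _ _ nusi) => //.
- exact: findim_rV.
- by move=> p [].
- apply: (@smooth_on_linear _ _ _ _ _ snd id) => //.
  + by move=> p; exact: snd_continuous.
  + exact: smooth_on_id.
Qed.

(** A tube argument: each point of the zero section has room inside [W] for nearby points and small
    [t], and compactness makes the bound on [t] uniform. *)
Lemma compact_fscal_section (nu : S -> N) (W : set N) : compact [set: S] ->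
  smooth_section nu -> open W -> (forall x, W (fzero N x)) ->
  exists2 e : R, 0 < e & forall t y, - e < t < e -> W (fscal N t (nu y)).
Proof.
move=> cS [nus nuP] oW W0.
have /compact_near_coveringP /(_ R (nbhs (0 : R))
  (fun t y => W (fscal N t (nu y))) _) := cS.
case=> [y _|r /= r0 rW]; last first.
  exists r => // t y tr; apply: rW => //.
  by rewrite /ball/= sub0r normrN ltr_norml.
pose i := at_ S y; have yi : dom S i y := dom_at y.
pose F (tz : R * 'rV[R]_m) := fscal N tz.1 (nu (chinv S i tz.2)).
have sF : smooth_into (setT `*` (chart S i @` dom S i)) F.
  by apply: smooth_into_fscal_section => //; exact: openT.
have Fc : {for (0, chart S i y), continuous F}.
  by apply: sF.1; split=> //; exists y.
(* The covering lemma produces pairs (point, parameter), while [F] takes the parameter first and the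
   point in a chart. *)
pose r (p : S * R) := (p.2, chart S i p.1).
have rc : {for (y, 0), continuous r}.
  have c1 : (fun p : S * R => p.2) @ nbhs (y, 0 : R) --> nbhs (0 : R).
    exact: cvg_snd.
  have c2 : (fun p : S * R => chart S i p.1) @ nbhs (y, 0 : R) --> nbhs (chart S i y).
    apply: (@cvg_comp _ _ _ fst (chart S i) _ (nbhs y)); first exact: cvg_fst.
    exact: chart_continuous.
  exact: (cvg_pair c1 c2).
have FW : \forall p \near (y, 0 : R), W (F (r p)).
  apply: (rc (fun q => W (F q))); apply: Fc; rewrite /F/= chartK// fscal0 nuP.
  exact: open_nbhs_nbhs.
have ydom : \forall p \near (y, 0 : R), dom S i p.1.
  by apply: (@cvg_fst _ _ (nbhs y) (nbhs (0 : R))); exact: near_dom.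
by apply: filterS2 FW ydom => p + pi; rewrite /F/= chartK.
Qed.

Lemma smooth_family_fscal (nu : S -> N) (W : set N) (phi : N -> M) e :
  smooth_section nu -> open W -> smooth_map W phi ->
  (forall t y, - e < t < e -> W (fscal N t (nu y))) ->
  smooth_family e (fun t y => phi (fscal N t (nu y))).
Proof.
move=> [nus _] oW phis We i; rewrite /smooth_family.
have oI := @open_itvoo _ (- e) e.
apply: (@smooth_into_map _ _ _ _ _ _ _ W
  (fun tz : R * 'rV[R]_m => fscal N tz.1 (nu (chinv S i tz.2))) phi) => //; last first.
- exact: smooth_into_fscal_section.
- by move=> p [pe _]; exact: We.
- by apply: open_setX => //; exact: cod_open.
Qed.

(** [acs_smooth] controls [J] only on fields with constant chart coordinates; this expansion extends
    the control to moving vectors. *)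
Lemma coord_acs (J : almost_complex M) a q w : dom M a q ->
  coord a q (J q w) = \sum_l (coord a q w) 0 l *:
    coord a q (J q (vec a q (delta_mx 0 l))).
Proof.
move=> aq; rewrite -[in LHS](coordK w aq).
apply: (linear_rV_sum (f := fun w => coord a q (J q (vec a q w)))).
by move=> c v v'; rewrite vec_linear acs_linear coord_linear.
Qed.

(** [tmap (U t)] is written in the preferred chart at [U t x], which may jump with [t]. In the fixed
    chart [a] it becomes a partial derivative [X] of one smooth function of [(t, z)], and [J]
    becomes the smooth columns [Y]. *)
Lemma smooth_dbar_family (j : almost_complex S) (J : almost_complex M) e U x a xi :
  smooth_family e U ->
  smooth_on ([set t | - e < t < e] `&` (fun t => U t x) @^-1` dom M a)
    (fun t => coord a (U t x) (dbar j J (U t) x xi)).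
Proof.
move=> sU; pose i := at_ S x; have xi_ : dom S i x := dom_at x.
set I := [set t | _]; have oI : open I by exact: open_itvoo.
pose z0 := chart S i x.
pose F (tz : R * 'rV[R]_m) := U tz.1 (chinv S i tz.2).
have sF : smooth_into (I `*` (chart S i @` dom S i)) F := sU i.
have oD : open (I `*` (chart S i @` dom S i)).
  by apply: open_setX => //; exact: cod_open.
have sz (A : set R) : open A -> smooth_on A (fun t : R => (t, z0)).
  by move=> oA; apply: smooth_on_pair => //; [exact: smooth_on_id|exact: smooth_on_cst].
have sUx : smooth_into I (fun t => U t x).
  apply: (@smooth_into_eq _ _ _ _ _ (fun t => F (t, z0))) => //.
    by move=> t _; rewrite /F/= chartK.
  apply: smooth_into_precomp sF => //.
  - by apply: findim_prod; [exact: findim_R|exact: findim_rV].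
  - by move=> t It; split=> //; exists x.
  - exact: sz.
set A := I `&` _.
have oA : open A by apply: open_preimage sUx.1 => //; exact: dom_open.
pose B := (I `*` (chart S i @` dom S i)) `&` F @^-1` dom M a.
have oB : open B by apply: open_preimage sF.1 => //; exact: dom_open.
have sFa : smooth_on B (chart M a \o F) := sF.2 a.
have AB t : A t -> B (t, z0).
  by move=> [It Ut]; do 2?split=> //; [exists x|rewrite /preimage/F/= chartK].
pose X v t := 'D_(0, v) (chart M a \o F) (t, z0).
have XE v t : A t -> coord a (U t x) (tmap (U t) x v) = X v t.
  move=> At; have [It Ut] := At.
  rewrite coord_tmap//; last first.
    apply: (@mdifferentiable_smooth _ _ _ _ _ setT) => //; first exact: openT.
    move=> l; rewrite chart_imageE setIT.
    apply: (@smooth_into_precomp _ 'rV[R]_m (R * 'rV[R]_m)%type _ _ _ _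
      (fun z => (t, z)) (fun tz => U tz.1 (chinv S l tz.2)) _ _ _ _ (sU l)).
    - by apply: findim_prod; [exact: findim_R|exact: findim_rV].
    - exact: cod_open.
    - by move=> z zl; split.
    - apply: smooth_on_pair; [exact: cod_open|exact: smooth_on_cst|exact: smooth_on_id].
  have dF := smooth_on_differentiable sFa (AB t At).
  by rewrite /X deriveE// -diff_slicer.
have sX v : smooth_on A (X v).
  apply: smooth_on_comp (smooth_on_derive (0, v) sFa) => //.
  - by apply: findim_prod; [exact: findim_R|exact: findim_rV].
  - exact: sz.
pose Y l t := coord a (U t x) (J (U t x) (vec a (U t x) (delta_mx 0 l))).
have sY l : smooth_on A (Y l).
  apply: smooth_on_into (@acs_smooth _ _ _ J a (delta_mx 0 l)) => //.
  - exact: dom_open.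
  - by move=> t [].
  - by apply: smooth_intoS sUx => t [].
have JE w t : A t -> coord a (U t x) (J (U t x) w) =
    \sum_l (coord a (U t x) w) 0 l *: Y l t.
  by move=> [It Ut]; exact: coord_acs.
apply: (@smooth_on_eq _ _ _ _ (fun t => 2^-1 *: (X xi t +
    \sum_l (X (j x xi) t) 0 l *: Y l t))) => //.
  by move=> t At; rewrite /dbar coordZ coordD JE// !XE.
apply: smooth_on_scale => //; first exact: smooth_on_cst.
apply: smooth_on_add => //; apply: smooth_on_sum => // l.
apply: smooth_on_scale => //.
exact: smooth_on_coord.
Qed.

End Families.

(** * The limit of the dilatations *)

Section Limits.
Context {R : realType}.

Lemma cvg_sumr (T : Type) (F : set_system T) (FF : Filter F)
    (V : normedModType R) (I : Type) (r : seq I) (f : I -> T -> V) (l : I -> V) :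
  (forall i, f i @ F --> l i) ->
  (fun x => \sum_(i <- r) f i x) @ F --> \sum_(i <- r) l i.
Proof.
by move=> fl; apply: cvg_big => //; exact: add_continuous.
Qed.

Lemma cvg_dnbhs_continuous (V : normedModType R) (f : R -> V) x :
  {for x, continuous f} -> f t @[t --> x^'] --> f x.
Proof. by move=> fx; exact: cvg_within_filter. Qed.

Lemma cvg_quotient0 (V : normedModType R) (f : R -> V) :
  differentiable f 0 -> f 0 = 0 -> t^-1 *: f t @[t --> 0^'] --> 'D_1 f 0.
Proof.
move=> df f0; have fd : derivable f 0 1 by exact: diff_derivable.
suff -> : (fun t => t^-1 *: f t) =
    (fun t : R => t^-1 *: ((f \o shift 0) (t *: (1 : R)) - f 0)) by exact: fd.
by apply/funext => t; rewrite /= f0 subr0 addr0 [t *: _]mulr1.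
Qed.

Lemma cvg_coord (T : Type) (F : set_system T) (FF : Filter F) l
    (f : T -> 'rV[R]_l) (v : 'rV[R]_l) i :
  f @ F --> v -> (f t 0 i : R) @[t --> F] --> (v 0 i : R).
Proof.
move=> fv; apply: (@cvg_comp _ _ _ f (fun w : 'rV[R]_l => w 0 i) F _ _ fv).
exact: coord_continuous.
Qed.

(* Below, [b t] is [dbar_J u_t] in a chart, [alpha l] and [beta l] are the    *)
(* partial derivatives of the exponential map in the base and fiber directions *)
(* along the segment [t |-> (z0, t *: w0)], and [(zeta t, omega t)] are the    *)
(* components of [eta_t].                                                      *)
Section Degeneration.
Variables (m n k : nat) (b : R -> 'rV[R]_n).
Variables (alpha : 'I_m -> R -> 'rV[R]_n) (beta : 'I_k -> R -> 'rV[R]_n).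
Variables (zeta : R -> 'rV[R]_m) (omega : R -> 'rV[R]_k).
Variables (zeta0 : 'rV[R]_m) (omega0 : 'rV[R]_k).
Hypothesis bE : \forall t \near (0 : R)^',
  b t = \sum_i zeta t 0 i *: alpha i t + t *: \sum_l omega t 0 l *: beta l t.
Hypotheses (zetaC : zeta @ (0 : R)^' --> zeta0)
  (omegaC : omega @ (0 : R)^' --> omega0).
Hypothesis alphaD : forall i, differentiable (alpha i) 0.
Hypothesis betaC : forall l, {for 0, continuous (beta l)}.
Hypotheses (bD : differentiable b 0) (b0 : b 0 = 0).

Lemma degeneration_limit : \sum_i zeta0 0 i *: alpha i 0 = 0.
Proof.
have bc : b t @[t --> (0 : R)^'] --> (0 : 'rV[R]_n).
  by rewrite -[X in _ --> X]b0; apply: cvg_dnbhs_continuous;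
     exact: differentiable_continuous.
have tc : (t : R) @[t --> (0 : R)^'] --> (0 : R).
  exact: (@cvg_dnbhs_continuous _ (fun t : R => t) 0 (@cvg_id _ _)).
have S1 : (fun t => \sum_i zeta t 0 i *: alpha i t) @ (0 : R)^' -->
    \sum_i zeta0 0 i *: alpha i 0.
  apply: cvg_sumr => i; apply: cvgZ; first exact: cvg_coord.
  by apply: cvg_dnbhs_continuous; exact: differentiable_continuous.
have S2 : (fun t => \sum_l omega t 0 l *: beta l t) @ (0 : R)^' -->
    \sum_l omega0 0 l *: beta l 0.
  apply: cvg_sumr => i; apply: cvgZ; first exact: cvg_coord.
  exact: cvg_dnbhs_continuous.
have S : (fun t => \sum_i zeta t 0 i *: alpha i t +
    t *: \sum_l omega t 0 l *: beta l t) @ (0 : R)^' -->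
    \sum_i zeta0 0 i *: alpha i 0 + 0 *: \sum_l omega0 0 l *: beta l 0.
  by apply: cvgD => //; exact: cvgZ.
rewrite scale0r addr0 in S.
apply: (cvg_unique (@norm_hausdorff _ _) _ bc).
apply: cvg_trans S; apply: near_eq_cvg.
by apply: filterS bE => t ->.
Qed.

(** The factor [t^-1] is moved onto [L (alpha i t)], whose quotient has a finite limit because it
    vanishes at 0; multiplied by [zeta t], which tends to 0, it disappears. Thus [zeta] and [omega]
    need only converge. *)
Lemma degeneration_derivative q (L : {linear 'rV[R]_n -> 'rV[R]_q}) :
  zeta0 = 0 -> (forall i, L (alpha i 0) = 0) ->
  L ('D_1 b 0) = \sum_l omega0 0 l *: L (beta l 0).
Proof.
move=> z0 La0.
have Lc : continuous L by apply: findim_linear_continuous; exact: findim_rV.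
have Ld y : differentiable L y by exact: linear_differentiable.
have dL f : differentiable f (0 : R) -> differentiable (fun t => L (f t)) 0.
  by move=> df; apply: (@differentiable_comp _ _ _ _ f L).
have LbC : t^-1 *: L (b t) @[t --> (0 : R)^'] --> L ('D_1 b 0).
  have -> : L ('D_1 b 0) = 'D_1 (fun t => L (b t)) 0.
    by rewrite [RHS]derive_comp// diff_lin.
  by apply: cvg_quotient0; [exact: dL|rewrite b0 linear0].
have S1 : (fun t => \sum_i zeta t 0 i *: (t^-1 *: L (alpha i t))) @ (0 : R)^' -->
    \sum_i zeta0 0 i *: 'D_1 (fun t => L (alpha i t)) 0.
  apply: cvg_sumr => i; apply: cvgZ; first exact: cvg_coord.
  by apply: cvg_quotient0; [exact: dL|exact: La0].
have S2 : (fun t => \sum_l omega t 0 l *: L (beta l t)) @ (0 : R)^' -->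
    \sum_l omega0 0 l *: L (beta l 0).
  apply: cvg_sumr => i; apply: cvgZ; first exact: cvg_coord.
  apply: cvg_dnbhs_continuous.
  by apply: (@continuous_comp _ _ _ (beta i) L); [exact: betaC|exact: Lc].
have S : (fun t => \sum_i zeta t 0 i *: (t^-1 *: L (alpha i t)) +
    \sum_l omega t 0 l *: L (beta l t)) @ (0 : R)^' -->
    \sum_l omega0 0 l *: L (beta l 0).
  rewrite -[X in _ --> X]add0r; apply: cvgD => //.
  by move: S1; rewrite big1// => i _; rewrite z0 mxE scale0r.
apply: (cvg_unique (@norm_hausdorff _ _) LbC).
apply: cvg_trans S; apply: near_eq_cvg.
near=> t; have t0 : t != 0 by near: t; exact: nbhs_dnbhs_neq.
have -> : b t = \sum_i zeta t 0 i *: alpha i t + t *: \sum_l omega t 0 l *: beta l t.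
  by near: t.
rewrite linearD linearZ/= scalerDr scalerA mulVf// scale1r !linear_sum/=.
have LZ r v : L (r *: v) = r *: L v by rewrite linearZ.
congr (_ + _); apply: eq_bigr => i _; rewrite LZ//.
by rewrite !scalerA mulrC.
Unshelve. all: by end_near. Qed.

End Degeneration.

End Limits.

(** * Tangent vectors of the bundle in a local trivialization *)

Section BundleCoordinates.
Context {R : realType} {m n k : nat} {B : manifold R m} {M : manifold R n}.
Variables (N : vbundle B k) (V : set B) (h : N -> 'rV[R]_k)
  (g : B -> 'rV[R]_k -> N).
Hypothesis tr : trivialization V h g.
Variables (e : N) (i : atlas_index B).
Hypotheses (Ve : V (proj N e)) (ie : dom B i (proj N e)).

Let c := at_ N e.
Let y0 := chart N c e.
Let z0 := chart B i (proj N e).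
Let w0 := h e.

Definition triv_map (zw : 'rV[R]_m * 'rV[R]_k) : N := g (chinv B i zw.1) zw.2.
(** Together with [fiber_coord] this inverts [triv_map], read in the chart of [N] at [e]. The two
    components stay apart because dilatations act on the second only. *)
Definition base_coord (y : 'rV[R]_(m + k)) : 'rV[R]_m :=
  chart B i (proj N (chinv N c y)).
Definition fiber_coord (y : 'rV[R]_(m + k)) : 'rV[R]_k := h (chinv N c y).
Definition triv_dom : set ('rV[R]_m * 'rV[R]_k) :=
  (chart B i @` (dom B i `&` V)) `*` setT.

Lemma open_triv_dom : open triv_dom.
Proof.
apply: open_setX; last exact: openT.
by apply: open_chart_image; exact: triv_open tr.
Qed.

Lemma smooth_triv_map : smooth_into triv_dom triv_map.
Proof. by have [_ _ _ [_ /(_ i) sg] _] := tr; exact: sg. Qed.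

Lemma triv_dom0 w : triv_dom (z0, w).
Proof. by split=> //=; exists (proj N e). Qed.

Lemma triv_map0 w : triv_map (z0, w) = g (proj N e) w.
Proof. by rewrite /triv_map/= chartK. Qed.

Lemma differentiable_base_coord : differentiable base_coord y0.
Proof.
have := mdifferentiable_smooth (x := e) openT I (@proj_smooth _ _ _ _ N).
by move=> [_]; apply => //; exact: dom_at.
Qed.

Lemma differentiable_fiber_coord : differentiable fiber_coord y0.
Proof.
have [_ _ _ [/(_ c) sh _] _] := tr.
apply: smooth_on_differentiable sh _.
by exists e => //; split=> //; exact: dom_at.
Qed.

Lemma near_triv : \forall y \near y0, [/\ (chart N c @` dom N c) y,
  V (proj N (chinv N c y)) & dom B i (proj N (chinv N c y))].
Proof.
have ce : dom N c e := dom_at e.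
have ViN : \forall q \near e, V (proj N q) /\ dom B i (proj N q).
  have [pc _] := mdifferentiable_smooth (x := e) openT I (@proj_smooth _ _ _ _ N).
  apply: (pc (fun b => V b /\ dom B i b)); apply: filterI; last exact: near_dom.
  by apply: open_nbhs_nbhs; split=> //; exact: triv_open tr.
by apply: filterS2 (near_chart_image ce) (near_chinv ce ViN) => y ? [].
Qed.

(** In the trivialization the dilatation is [(z, w) |-> (z, t *: w)]; this is the source of the
    factor [t] on the fiber component. *)
Lemma coord_tmap_fscal (phi : N -> M) a t eta :
  mdifferentiable phi (fscal N t e) -> dom M a (phi (fscal N t e)) ->
  differentiable (chart M a \o phi \o triv_map) (z0, t *: w0) ->
  coord a (phi (fscal N t e)) (tmap (phi \o fscal N t) e eta) =
  'd (chart M a \o phi \o triv_map) (z0, t *: w0)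
    ('d base_coord y0 eta, t *: 'd fiber_coord y0 eta).
Proof.
move=> dphi ae dPhi.
have dm : mdifferentiable (fscal N t) e.
  exact: (mdifferentiable_smooth (x := e) openT I (@smooth_fscal _ _ _ _ N t)).
rewrite (coord_tmap (f := phi \o fscal N t))//; last exact: mdifferentiable_comp.
pose f y := (base_coord y, t *: fiber_coord y).
have dtf : differentiable (fun y => t *: fiber_coord y) y0.
  exact: (differentiableZ t differentiable_fiber_coord).
have df : differentiable f y0.
  exact: differentiable_pair differentiable_base_coord dtf.
have f0 : f y0 = (z0, t *: w0).
  by rewrite /f /base_coord /fiber_coord /y0 !chartK//; exact: dom_at.
rewrite -(@diff_near _ _ _ ((chart M a \o phi \o triv_map) \o f)); last first.
- by apply: differentiable_comp => //; rewrite f0.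
- apply: filterS near_triv => y [cy Vy iy] /=.
  by rewrite /triv_map/= chartK// (triv_scal tr).
rewrite diff_comp_eq// ?f0//; congr ('d _ _ _).
rewrite /f diff_pair//=; last exact: differentiable_base_coord.
congr pair.
have := diffZ t differentiable_fiber_coord.
by move=> /(congr1 (fun F => F eta)).
Qed.

Lemma differentiable_triv_chart : differentiable (chart N c \o triv_map) (z0, w0).
Proof.
apply: smooth_on_differentiable (smooth_triv_map.2 c) _; split.
  exact: triv_dom0.
by rewrite /preimage/= triv_map0 (triv_inv tr)//; exact: dom_at.
Qed.

Lemma tangent_decomposition eta :
  eta = 'd (chart N c \o triv_map) (z0, w0) ('d base_coord y0 eta, 'd fiber_coord y0 eta).
Proof.
pose f y := (base_coord y, fiber_coord y).
have df : differentiable f y0.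
  exact: differentiable_pair differentiable_base_coord differentiable_fiber_coord.
have f0 : f y0 = (z0, w0).
  by rewrite /f /base_coord /fiber_coord /y0 !chartK//; exact: dom_at.
have dQ := differentiable_triv_chart.
transitivity ('d (fun y : 'rV[R]_(m + k) => y) y0 eta).
  by rewrite -deriveE; [rewrite derive_id|exact: differentiable_id].
rewrite -(@diff_near _ _ _ ((chart N c \o triv_map) \o f)); last first.
- by apply: differentiable_comp => //; rewrite f0.
- apply: filterS near_triv => y [cy Vy iy] /=.
  by rewrite /triv_map/= chartK// (triv_inv tr)// chinvK.
rewrite diff_comp_eq// ?f0//; congr ('d _ _ _).
rewrite /f diff_pair//=; first exact: differentiable_base_coord.
exact: differentiable_fiber_coord.
Qed.

(** In fiber coordinates the curve defining [vlift] is the straight line [w0 + t *: w] over a fixed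
    base point. *)
Lemma vlift_triv w : vlift e (g (proj N e) w) =
  'd (chart N c \o triv_map) (z0, w0) (0, w).
Proof.
have addE t : fadd N e (fscal N t (g (proj N e) w)) = g (proj N e) (w0 + t *: w).
  rewrite (triv_add tr)// ?proj_fscal ?(triv_proj tr)//.
  by rewrite (triv_scal tr) ?(triv_proj tr)// !(trivK tr).
rewrite /vlift /velocity addE scale0r addr0 (triv_inv tr)//.
rewrite -derive_line; last exact: differentiable_triv_chart.
have -> : chart N (at_ N e) \o (fun t : R => fadd N e (fscal N t (g (proj N e) w))) =
    fun t : R => (chart N c \o triv_map) ((z0, w0) + t *: (0, w)) => //.
apply/funext => t /=; rewrite addE -triv_map0.
congr (chart N c (triv_map _)).
by rewrite [RHS]surjective_pairing/= scaler0 addr0.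
Qed.

End BundleCoordinates.

(** * Comparison of the Gromov operator with the Cauchy-Riemann operator *)

Section GromovOperator.
Context {R : realType} {m n k : nat} {M : manifold R n} {S : manifold R m}.
Variables (J : almost_complex M) (j : almost_complex S) (u : S -> M).
Variables (N : vbundle S k) (pi : S -> 'rV[R]_n -> N) (s : N -> 'rV[R]_n).
Variables (D : connection M) (W : set N) (phi : N -> M).
Hypotheses (u_smooth : smooth_map setT u)
  (u_immersion : forall x, injective (tmap u x)) (u_hol : pseudoholomorphic j J u).
Hypothesis N_normal : normal_bundle u pi.
Hypotheses (s_complement : invariant_complement J u pi s)
  (phi_exp : exponential_map u s D W phi).
Variable nu : S -> N.
Hypothesis nu_section : smooth_section nu.

(** Makes [s \o nu] an admissible argument of [induced_operator]. In a chart, [s] is a smooth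
    function [sigma] on an open part of [N], which is pulled back by [nu]. *)
Lemma smooth_along_complement : smooth_along setT u (fun y => s (nu y)).
Proof.
have [_ _ _ ss _] := s_complement; have [nus nuP] := nu_section.
move=> i a; pose sigma e := coord a (u (proj N e)) (s e).
have oua : open (u @^-1` dom M a).
  rewrite -[X in open X]setTI; apply: open_preimage => //; first exact: openT.
    exact: dom_open.
  by move=> y _; exact: (mdifferentiable_smooth (x := y) openT I u_smooth).1.
have oupa : open ((u \o proj N) @^-1` dom M a).
  rewrite comp_preimage -[X in open X]setTI; apply: open_preimage => //.
    exact: openT.
  by move=> y _; exact: (mdifferentiable_smooth (x := y) openT I
    (@proj_smooth _ _ _ _ N)).1.
have ssigma : smooth_fun ((u \o proj N) @^-1` dom M a) sigma.
  by move=> c; have := ss c a; rewrite setIT.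
have := smooth_fun_comp (f := nu) oua oupa _ _ ssigma.
move=> /(_ _ _ i); rewrite setIT => H.
have {H} := H _ _.
rewrite (_ : (sigma \o nu) \o chinv S i = fun z =>
    coord a (u (chinv S i z)) (s (nu (chinv S i z)))).
  apply; first by move=> y uy; rewrite /preimage/= nuP.
  by move=> l; apply: smooth_intoS (nus l) => _ [y [ly _] <-]; exists y.
by apply/funext => z; rewrite /sigma/= nuP.
Qed.

Lemma tmap_fscalK (e : N) t v : t != 0 ->
  tmap (fscal N t) e (tmap (fscal N t^-1) (fscal N t e) v) = v.
Proof.
move=> t0; have K (e' : N) : fscal N t^-1 (fscal N t e') = e'.
  by rewrite fscal_fscal mulVf// fscal1.
have K' (e' : N) : fscal N t (fscal N t^-1 e') = e'.
  by rewrite fscal_fscal mulfV// fscal1.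
have d r (e' : N) : mdifferentiable (fscal N r) e'.
  exact: (mdifferentiable_smooth (x := e') openT I (@smooth_fscal _ _ _ _ N r)).
rewrite -[in tmap (fscal N t) e](K e) -tmap_comp//.
rewrite -[RHS](tmap_id (fscal N t e)); apply: tmap_near.
  by apply: nearW => e' /=.
by apply: mdifferentiable_comp.
Qed.

Definition rescaled_acs (t : R) (e : N) (v : 'rV[R]_(m + k)) : 'rV[R]_(m + k) :=
  tmap (fscal N t^-1) (fscal N t e)
    (pullback_acs J phi (fscal N t e) (tmap (fscal N t) e v)).

Lemma mdifferentiable_exponential e : W e -> mdifferentiable phi e.
Proof.
have [[oW _] _ phis _ _] := phi_exp.
by move=> We; exact: mdifferentiable_smooth oW We phis.
Qed.

(** For [t != 0] the differential of [phi \o fscal N t] intertwines [rescaled_acs t] with [J], since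
    the two opposite dilatations cancel. It can therefore be pulled out of the Cauchy-Riemann
    expression. *)
Lemma dbar_fscal_section t x xi : t != 0 -> W (fscal N t (nu x)) ->
  dbar j J (fun y => phi (fscal N t (nu y))) x xi =
  tmap (phi \o fscal N t) (nu x)
    (2^-1 *: (tmap nu x xi + rescaled_acs t (nu x) (tmap nu x (j x xi)))).
Proof.
move=> t0 Wt; have [nus nuP] := nu_section.
have dphi := mdifferentiable_exponential Wt.
have dt : mdifferentiable (fscal N t) (nu x).
  exact: (mdifferentiable_smooth (x := nu x) openT I (@smooth_fscal _ _ _ _ N t)).
have dnu : mdifferentiable nu x.
  exact: (mdifferentiable_smooth (x := x) openT I nus).
have dpt : mdifferentiable (phi \o fscal N t) (nu x) by exact: mdifferentiable_comp.
rewrite /dbar tmapZ tmapD; congr (_ *: (_ + _)).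
  exact: (tmap_comp dnu dpt).
rewrite [in LHS](tmap_comp dnu dpt) !(tmap_comp dt dphi) /rescaled_acs.
by rewrite tmap_fscalK// (pullback_acsP J phi_exp).
Qed.

Lemma fiber_linear V h g x : trivialization (N := N) V h g -> V x ->
  linear (fun v => h (pi x v)).
Proof.
have [piP [piD piZ] _ _ _] := N_normal.
move=> tr Vx c v w; rewrite piD piZ (triv_add tr) ?proj_fscal ?piP//.
by rewrite (trivK tr)// (triv_scal tr) ?piP// (trivK tr).
Qed.

Hypothesis S_closed : compact [set: S].
Variable Jc : almost_complex N.
Hypothesis Jc_limit : dilatation_limit J phi Jc.

(** The hypothesis on [Dv] is what [linearization] says at one [x] and [xi] for the field [s \o nu],
    so the argument concerns a single vector and one well-chosen family. *)
Theorem gromov_operator_dbar (Dv : 'rV[R]_n) x xi :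
  (forall (e : R) (U : R -> S -> M), 0 < e -> smooth_family e U ->
     (forall y, U 0 y = u y) ->
     (forall y, velocity (fun t => U t y) 0 = s (nu y)) ->
     Dv = 'D_1 (fun t : R => coord (at_ M (u x)) (U t x) (dbar j J (U t) x xi)) 0) ->
  dbar j Jc nu x xi = vlift (nu x) (pi x Dv).
Proof.
have [[oW W0] _ phis _ _] := phi_exp.
have [nus nuP] := nu_section.
have [piP _ _ ker_pi _] := N_normal.
have [pis _ _ _ _] := s_complement.
have [e e0 We] := compact_fscal_section S_closed nu_section oW W0.
pose U t y := phi (fscal N t (nu y)).
have sU : smooth_family e U := smooth_family_fscal nu_section oW phis We.
have U0 y : U 0 y = u y.
  by rewrite /U fscal0 (exponential_ray s_complement phi_exp _).1 nuP.
move=> /(_ e U e0 sU U0 (fun y => (exponential_ray s_complement phi_exp _).2)).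
set a := at_ M (u x); pose b t := coord a (U t x) (dbar j J (U t) x xi).
rewrite -/b => DvE.
have [V [h [g [tr Vx]]]] := trivialization_at N x.
pose i := at_ S x; have ix : dom S i x := dom_at x.
have Ve : V (proj N (nu x)) by rewrite nuP.
have ie : dom S i (proj N (nu x)) by rewrite nuP.
pose c := at_ N (nu x); pose y0 := chart N c (nu x); pose z0 := chart S i (proj N (nu x)).
pose w0 := h (nu x).
pose G := triv_map g i; pose Phi := chart M a \o phi \o G.
pose p := base_coord (nu x) i; pose q := fiber_coord h (nu x).
pose eta t := 2^-1 *: (tmap nu x xi + rescaled_acs t (nu x) (tmap nu x (j x xi))).
set eta0 := dbar j Jc nu x xi.
pose Omega := @triv_dom _ _ k _ V i `&` G @^-1` W.
have oT := @open_triv_dom _ _ _ _ _ _ _ _ tr i.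
have sG := smooth_triv_map tr i.
have oO : open Omega by apply: open_preimage => // zw; exact: sG.1.
have sphiG : smooth_into Omega (fun zw => phi (G zw)).
  apply: smooth_into_map phis => //; first by move=> zw [].
  by apply: smooth_intoS sG => zw [].
pose Omega' := Omega `&` (fun zw => phi (G zw)) @^-1` dom M a.
have oO' : open Omega'.
  by apply: open_preimage sphiG.1 => //; exact: dom_open.
have sPhi : smooth_on Omega' Phi := sphiG.2 a.
have G0 w : G (z0, w) = g x w by rewrite /G /triv_map/= chartK// nuP.
have phi0 y : phi (fzero N y) = u y.
  by have := (exponential_ray s_complement phi_exp (fzero N y)).1; rewrite proj_fzero.
have O0 : Omega' (z0, 0).
  split; first split.
  - by split=> //=; exists (proj N (nu x)).
  - by rewrite /preimage/= G0 -(triv_zero tr).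
  - by rewrite /preimage/= G0 -(triv_zero tr)// phi0; exact: dom_at.
(* The segment from the zero vector to [nu x] in the trivialization: [G (line t)] is
   [fscal N t (nu x)]. *)
pose line t : 'rV[R]_m * 'rV[R]_k := (z0, t *: w0).
have sline : smooth_on setT line.
  apply: smooth_on_pair; first exact: openT; first exact: smooth_on_cst.
  apply: smooth_on_scale; [exact: openT|exact: smooth_on_id|exact: smooth_on_cst].
have line0 : line 0 = (z0, 0) by rewrite /line scale0r.
have lc : {for 0, continuous line} by exact: smooth_on_continuous sline I.
have Oline : \forall t \near (0 : R), Omega' (line t).
  by apply: (lc Omega'); apply: open_nbhs_nbhs; split=> //; rewrite line0.
have dline : differentiable line 0 by exact: smooth_on_differentiable sline I.
have dDPhi v : differentiable (fun t => 'D_v Phi (line t)) 0.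
  apply: (@differentiable_comp _ _ _ _ line (fun zw => 'D_v Phi zw)) => //.
  rewrite line0.
  exact: smooth_on_differentiable (smooth_on_derive v sPhi) O0.
have dPhi0 : differentiable Phi (z0, 0) by exact: smooth_on_differentiable sPhi O0.
pose alpha l t := 'D_(delta_mx 0 l, 0) Phi (line t).
pose beta l t := 'D_(0, delta_mx 0 l) Phi (line t).
pose zeta t := 'd p y0 (eta t); pose omega t := 'd q y0 (eta t).
pose zeta0 := 'd p y0 eta0; pose omega0 := 'd q y0 eta0.
(* The dilatation limit is used only here, at [nu x] and for the vector [tmap nu x (j x xi)]. *)
have etaC : eta @ (0 : R)^' --> eta0.
  apply: cvgZ; first exact: cvg_cst.
  apply: cvgD; first exact: cvg_cst.
  exact: Jc_limit.
have zetaC : zeta @ (0 : R)^' --> zeta0.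
  apply: (@cvg_comp _ _ _ eta ('d p y0) _ _ _ etaC).
  by apply: diff_continuous; exact: differentiable_base_coord.
have omegaC : omega @ (0 : R)^' --> omega0.
  apply: (@cvg_comp _ _ _ eta ('d q y0) _ _ _ etaC).
  by apply: diff_continuous; exact: (differentiable_fiber_coord tr Ve).
have bE : \forall t \near (0 : R)^',
    b t = \sum_l zeta t 0 l *: alpha l t + t *: \sum_l omega t 0 l *: beta l t.
  near=> t; have t0 : t != 0 by near: t; exact: nbhs_dnbhs_neq.
  have Ot : Omega' (line t) by near: t; exact: nbhs_dnbhs.
  have Gt : G (line t) = fscal N t (nu x) by rewrite G0 (triv_scal tr)// nuP.
  have [[_ Wt] at_] := Ot; rewrite /preimage/= Gt in Wt at_.
  rewrite /b (dbar_fscal_section _ t0 Wt).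
  rewrite (coord_tmap_fscal tr Ve ie _ (mdifferentiable_exponential Wt))//; last first.
    exact: smooth_on_differentiable sPhi Ot.
  rewrite diff_prod_rV; last exact: smooth_on_differentiable sPhi Ot.
  congr (_ + _); rewrite scaler_sumr; apply: eq_bigr => l _.
  by rewrite mxE scalerA.
have bD : differentiable b 0.
  have sb := smooth_dbar_family j J x a xi sU.
  apply: smooth_on_differentiable sb _; split; first by rewrite /= oppr_lt0 e0.
  by rewrite /preimage/= U0; exact: dom_at.
have b0 : b 0 = 0.
  have Uu : U 0 = u by apply/funext.
  by rewrite /b Uu /dbar u_hol acs_sqr subrr scaler0 /coord linear0.
(* [phi] restricts to [u] on the zero section, so its base derivative there is [du]. *)
have dPhi_base z : 'd Phi (z0, 0) (z, 0) = tmap u x z.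
  transitivity ('d (chart M a \o u \o chinv S i) z0 z); last first.
    by rewrite /tmap /z0 nuP.
  rewrite -(diff_slicel z dPhi0).
  apply: diff_near; last exact: (differentiable_slicel dPhi0).
  have : \forall z \near z0, (chart S i @` (dom S i `&` V)) z.
    apply: open_nbhs_nbhs; split; last by exists (proj N (nu x)).
    by apply: open_chart_image; exact: triv_open tr.
  apply: filterS => _ [y [iy Vy] <-] /=.
  by rewrite /Phi/= /G /triv_map/= chartK// -(triv_zero tr)// phi0.
(* The line through [(z0, 0)] in direction [w] is the fiber ray of [g x w], sent by [phi] to a curve
   with initial velocity [s (g x w)]. *)
have dPhi_fiber w : 'd Phi (z0, 0) (0, w) = s (g x w).
  have [_ <-] := exponential_ray s_complement phi_exp (g x w).
  rewrite /velocity fscal0 (triv_proj tr)// phi0 -/a -derive_line//.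
  have -> // : (fun t : R => Phi ((z0, 0) + t *: (0, w))) =
      chart M a \o (fun t => phi (fscal N t (g x w))).
  apply/funext => t; rewrite /Phi/=; congr (chart M a (phi _)).
  rewrite (triv_scal tr) (triv_proj tr)// (trivK tr)// -G0; congr G.
  by rewrite [LHS]surjective_pairing/= scaler0 addr0 add0r.
have alphaD l : differentiable (alpha l) 0 by exact: dDPhi.
have betaC l : {for 0, continuous (beta l)}.
  by apply: differentiable_continuous; exact: dDPhi.
have zeta0E : zeta0 = 0.
  apply: (u_immersion (x := x)); rewrite -!dPhi_base.
  have sum0 := degeneration_limit bE zetaC omegaC alphaD betaC bD b0.
  rewrite /alpha line0 in sum0; rewrite [LHS]diff_prod_rV// sum0.
  rewrite add0r big1 => [|l _]; last by rewrite mxE scale0r.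
  by rewrite (_ : (0, 0) = 0)// linear0.
(* The projection to the normal fiber, read in the trivialization; its kernel contains every
   [alpha l 0], a vector tangent to the curve. *)
pose L : {linear 'rV[R]_n -> 'rV[R]_k} := HB.pack (fun v => h (pi x v))
  (GRing.isLinear.Build _ _ _ _ _ (fiber_linear tr Vx)).
have La l : L (alpha l 0) = 0.
  rewrite /alpha line0 deriveE// dPhi_base /=.
  rewrite (ker_pi x _).2; last by exists (delta_mx 0 l).
  by rewrite (triv_zero tr)// (trivK tr).
have := degeneration_derivative bE zetaC omegaC alphaD betaC bD b0 zeta0E La.
rewrite -DvE.
(* The sum is [L] applied to [s (g x omega0)], and [pi] undoes [s]. *)
have -> : \sum_l omega0 0 l *: L (beta l 0) = omega0.
  transitivity (L ('d Phi (z0, 0) (0, omega0))).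
    rewrite diff_prod_rV// [X in L (X + _)]big1 ?add0r => [|l _]; last first.
      by rewrite mxE scale0r.
    rewrite linear_sum; apply: eq_bigr => l _.
    by rewrite /= (linear_scale _ _ (fiber_linear tr Vx)) /beta line0.
  rewrite dPhi_fiber /=; have := pis (g x omega0).
  by rewrite (triv_proj tr)// => ->; rewrite (trivK tr).
move=> /= Dvh.
have -> : pi x Dv = g (proj N (nu x)) omega0.
  by rewrite -Dvh -[in LHS](triv_inv tr (e := pi x Dv)) ?piP// nuP.
rewrite (vlift_triv tr (i := i))// -[LHS]/eta0.
rewrite [LHS](tangent_decomposition tr (i := i) Ve ie).
by rewrite -/c -/y0 -/p -/q -/omega0 -/zeta0 zeta0E.
Unshelve. all: by end_near. Qed.

End GromovOperator.

Theorem proposition26 (R : realType) (n k : nat)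
  (M : manifold R n) (J : almost_complex M)
  (S : manifold R 2) (j : almost_complex S) (S_closed : compact [set: S])
  (u : S -> M) (u_embedding : embedding u) (u_hol : pseudoholomorphic j J u)
  (N : vbundle S k) (pi : S -> 'rV[R]_n -> N) (N_normal : normal_bundle u pi)
  (Jc : almost_complex N) (Jc_NBII : NBII_structure J u pi Jc)
  (D : (S -> 'rV[R]_n) -> S -> 'rV[R]_2 -> 'rV[R]_n)
  (D_lin : linearization j J u D)
  (Dc : (S -> N) -> S -> 'rV[R]_2 -> N) (Dc_ind : induced_operator u pi D Dc)
  (nu : S -> N) (nu_section : smooth_section nu) (x : S) (xi : 'rV[R]_2) :
  dbar j Jc nu x xi = vlift (nu x) (Dc nu x xi).
Proof.
have [u_smooth _ u_imm _] := u_embedding.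
have [s [nabla [W [phi [s_compl _ phi_exp Jc_lim]]]]] := Jc_NBII.
(* [s \o nu] is a lift of [nu] to a section of the pulled-back tangent bundle, so [Dc nu] is the
   class of [D] applied to it. *)
have s_pi y : pi y (s (nu y)) = nu y.
  have [/(_ (nu y)) + _ _ _ _] := s_compl.
  by rewrite (nu_section.2 y).
have nuE : (fun y => pi y (s (nu y))) = nu by apply/funext.
have v_smooth := smooth_along_complement u_smooth s_compl nu_section.
have := Dc_ind _ v_smooth x xi; rewrite nuE => ->.
apply: (gromov_operator_dbar u_imm u_hol N_normal s_compl phi_exp nu_section
  S_closed Jc_lim).
by move=> e U e0 sU U0 vU; exact: D_lin e0 sU U0 vU x xi.
Qed.
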